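(* Let $n\ge 1$, $m\ge 1$ and $s$ be integers with $1\le s\le n-1$. Consider the hexagon $H$ in the triangular lattice (unit equilateral triangles, with one family of lattice lines vertical) whose sides have lengths $n,n,2m,n,n,2m$ in cyclic order, the two sides of length $2m$ being vertical. Let $L$ be the horizontal symmetry axis of $H$ (the line through the midpoints of the two vertical sides); $L$ contains exactly $n+1$ lattice vertices of $H$, numbered $1,\dots,n+1$ from left to right. Let $P$ be the $(s+1)$-th of these vertices, and remove from $H$ the two unit triangles that have $P$ as a vertex and are bisected by $L$ (one immediately to the left and one immediately to the right of $P$, touching only at $P$). Then the number of rhombus tilings of the resulting region equals $$\frac{(2m-1)\binom{2m-2}{m-1}\binom{2n-2s}{n-s}\binom{2s}{s}}{\binom{2m+2n}{m+n}}\prod_{i=1}^{n}\prod_{j=1}^{n}\prod_{k=1}^{2m}\frac{i+j+k-1}{i+j+k-2}.$$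
   Context: A rhombus tiling of a region made of unit triangles of the triangular lattice is a tiling of the region by unit rhombi, each rhombus being the union of two unit equilateral triangles sharing a side. *)

(* Defs.v *)
From mathcomp Require Import all_boot all_order all_algebra.
From mathcomp Require Import finmap zify.

Set Implicit Arguments.
Unset Strict Implicit.
Unset Printing Implicit Defensive.

Import Order.TTheory GRing.Theory Num.Theory.

Local Open Scope fset_scope.
Local Open Scope ring_scope.

(* The pair (a, b) stands for the lattice vertex a u + b v of the plane, where
   u = (sqrt 3 / 2, 1 / 2) and v = (0, 1). The lattice lines {a = const} are
   vertical, and (a, b) lies at height (a + 2 b) / 2. *)
Notation vertex := (int * int)%type.

(* |a u + b v|^2 = a^2 + a b + b^2. *)
Definition sqdist (p q : vertex) : int :=
  let a := p.1 - q.1 in let b := p.2 - q.2 in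
  a ^+ 2 + a * b + b ^+ 2.

(* A triangle is represented by the set of its three corners. *)
Notation triangle := {fset vertex}.

Definition unit_triangle (t : triangle) : bool :=
  (#|` t| == 3)%N &&
  [forall p : t, forall q : t, (p != q) ==> (sqdist (val p) (val q) == 1)].

Definition share_side (t t' : triangle) : bool :=
  (#|` t `&` t'| == 2)%N.

Section Tilings.

Variable R : {fset triangle}.

Definition rhombus (B : {set R}) : bool :=
  [exists t : R, exists t' : R,
     share_side (val t) (val t') && (B == [set t; t'])].

Definition rhombus_tilings : {set {set {set R}}} :=
  [set P : {set {set R}} |
     partition P [set: R] && [forall B in P, rhombus B]].

End Tilings.

(* The vertices of the lattice in the hexagon with corners, in cyclic order,
   (0, m), (n, m), (2n, m - n), (2n, -m - n), (n, -m - n), (0, -m),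
   so that the horizontal symmetry axis is {a + 2 b = 0}; see in_hexagon. *)
Definition hexagon (n m : nat) : {fset vertex} :=
  [fset p : vertex in
     [seq (i%:Z, j%:Z - (m + n)%:Z) | i <- iota 0 (2 * n).+1,
                                      j <- iota 0 (2 * m + n).+1]
   | - m%:Z <= p.1 + p.2 <= (m + n)%:Z].

Lemma in_hexagon (n m : nat) (a b : int) :
  ((a, b) \in hexagon n m) =
  [&& 0 <= a <= (2 * n)%:Z, - (m + n)%:Z <= b <= m%:Z
    & - m%:Z <= a + b <= (m + n)%:Z].
Proof.
rewrite in_fset inE [RHS]andbA; congr andb.
apply/allpairsP/andP => [[[i j] []]|h].
  by rewrite !mem_iota /= => hi hj [-> ->]; lia.
exists (absz a, absz (b + (m + n)%:Z)); rewrite !mem_iota /=.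
by split; [lia | lia | congr pair; lia].
Qed.

Definition hexagon_triangles (n m : nat) : {fset triangle} :=
  [fset t : triangle in fpowerset (hexagon n m) | unit_triangle t].

(* The reflection in the axis {a + 2 b = 0}. *)
Definition axis_reflection (p : vertex) : vertex := (p.1, - p.1 - p.2).

(* The vertices on the axis, numbered from 0. *)
Definition axis_vertex (i : nat) : vertex := ((2 * i)%:Z, - i%:Z).

Lemma axis_hexagonP (n m : nat) (p : vertex) :
  reflect (exists2 i : nat, (i <= n)%N & p = axis_vertex i)
          ((p \in hexagon n m) && (axis_reflection p == p)).
Proof.
case: p => a b; rewrite in_hexagon /axis_reflection /axis_vertex /=.
apply: (iffP andP) => [[h /eqP[e]]|[i hi [-> ->]]].
  by exists (absz b); [lia | congr pair; lia].
by split; [lia | apply/eqP; congr pair => /=; lia].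
Qed.

Definition axis_symmetric (t : triangle) : bool :=
  [fset axis_reflection p | p in t] == t.

(* The hexagon without the unit triangles bisected by the axis of which
   axis_vertex s is a corner (one to the left and one to the right
   of this vertex if 0 < s < n). *)
Definition holey_hexagon (n m s : nat) : {fset triangle} :=
  [fset t in hexagon_triangles n m
   | ~~ ((axis_vertex s \in t) && axis_symmetric t)].

(* Main.v *)
(* Sweep the hexagon from left to right, one vertical lattice line at a time,
   and record the unit edges of the line that are not the short diagonal of a
   rhombus. These edges move down by 0 or 1 (in the oblique coordinate) at each
   step, so they trace 2m lattice paths from the left side; one of them is
   absorbed by the left hole and a new one starts at the right hole. Matching
   the triangles of a strip one after the other is the multilinear expansion of
   a path-counting determinant, in which colliding paths give equal columns.
   The number of tilings is thus minus a bordered determinant with core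
   N = [C(2n, n+i-j)], i, j < 2m, i.e. det N * (w N^-1 u), where u and w count
   the paths into the left hole and out of the right hole.

   det N equals MacMahon's product. By reflection symmetry, y N = w reduces to
   the Hankel system  sum_l lam_l c(n+1+l+t) = c(n-s+t),  t < m, with
   c(k) = C(2k, k). As c(N+t)/c(N) is, up to a factor independent of t, a
   polynomial of degree < m in N, the lam_l are Lagrange interpolation weights
   at n-s for the nodes n+1, ..., n+m. Then  y u = sum_l lam_l c(s+l)  is a
   Pfaff-Saalschuetz sum. *)

Require Import Defs.
From mathcomp Require Import all_boot all_order all_algebra.
From mathcomp Require Import qpoly fingroup perm finmap zify ring lra.

Set Implicit Arguments.
Unset Strict Implicit.
Unset Printing Implicit Defensive.

Import Order.TTheory GRing.Theory Num.Theory.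

Local Open Scope fset_scope.
Local Open Scope ring_scope.

(** * Domino tilings of a finite graph *)

Section Domino.

Variables (T : finType) (adj : rel T).
Hypothesis adj_sym : symmetric adj.

Definition domino (B : {set T}) : bool :=
  [exists t : T, exists t' : T, adj t t' && (B == [set t; t'])].

Definition domino_tilings (A : {set T}) : {set {set {set T}}} :=
  [set P : {set {set T}} | partition P A && [forall B in P, domino B]].

Lemma card_domino_tilings0 : #|domino_tilings set0| = 1%N.
Proof.
rewrite (_ : domino_tilings set0 = [set set0]) ?cards1 //.
apply/setP => P; rewrite !inE partition_set0.
by case: eqP => // -> /=; apply/forallP => B; rewrite inE.
Qed.

Lemma domino_mem (B : {set T}) (t : T) :
  domino B -> t \in B -> exists2 t', adj t t' & B = [set t; t'].
Proof.
move=> /existsP[x /existsP[y /andP[xy /eqP ->]]]; rewrite !inE.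
case/orP => /eqP ->; first by exists y.
by exists x; rewrite 1?adj_sym // setUC.
Qed.

(** Deleting the block [B] is inverse to [P |-> B |: P]: as [B] is nonempty, it is never a block of
    a tiling of [A :\: B]. *)
Lemma card_domino_tilings_containing (A B : {set T}) :
  domino B -> B \subset A ->
  #|[set P in domino_tilings A | B \in P]| = #|domino_tilings (A :\: B)|.
Proof.
move=> dB sBA.
have B0 : B != set0.
  case/existsP: dB => x /existsP[y /andP[_ /eqP ->]].
  by apply/set0Pn; exists x; rewrite !inE eqxx.
have notB P : P \in domino_tilings (A :\: B) -> B \notin P.
  rewrite inE => /andP[pP _]; apply/negP => BP.
  have := partitionS pP BP; rewrite subsetD => /andP[_].
  by rewrite -setI_eq0 setIid (negbTE B0).
rewrite -(card_in_imset (f := fun P => B |: P)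
  (D := mem (domino_tilings (A :\: B)))).
  apply: eq_card => P; apply/idP/imsetP => [|[Q Qin ->]].
    rewrite !inE => /andP[/andP[pP /forallP dP] BP].
    exists (P :\ B); last by rewrite setD1K.
    rewrite inE partitionD1 //=; apply/forallP => C; apply/implyP.
    by rewrite !inE => /andP[_ CP]; have := dP C; rewrite CP.
  move: (Qin); rewrite !inE => /andP[pQ /forallP dQ].
  rewrite eqxx andbT; apply/andP; split.
    rewrite -(setID A B) (setIidPr sBA) partitionU1 //.
    by rewrite -setI_eq0 setIDA setIC -setIDA setDv setI0.
  apply/forallP => C; apply/implyP; rewrite !inE => /orP[/eqP -> //|CQ].
  by have := dQ C; rewrite CQ.
move=> P Q Pin Qin /= eqPQ.
by rewrite -(setU1K (notB P Pin)) eqPQ setU1K // notB.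
Qed.

(** Exactly one block of a tiling contains [t], so the tilings are sorted by the partner of [t] in
    that block. *)
Lemma card_domino_tilings_expand (A : {set T}) (t : T) : t \in A ->
  #|domino_tilings A| =
  (\sum_(t' in A | adj t t') #|domino_tilings (A :\: [set t; t'])|)%N.
Proof.
move=> tA.
transitivity (\sum_(t' in A | adj t t')
    #|[set P in domino_tilings A | [set t; t'] \in P]|)%N; last first.
  apply: eq_bigr => t' /andP[t'A tt']; apply: card_domino_tilings_containing.
    by apply/existsP; exists t; apply/existsP; exists t'; rewrite tt' eqxx.
  by rewrite subUset !sub1set tA.
rewrite -sum1_card.
under [RHS]eq_bigr => t' _.
  rewrite -sum1_card (eq_bigl (fun P =>
    (P \in domino_tilings A) && ([set t; t'] \in P)));
   last by move=> P; rewrite inE.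
  rewrite big_mkcondr /=; over.
rewrite exchange_big /=; apply: eq_bigr => P;
  rewrite inE => /andP[pP /forallP dP].
have tc : t \in cover P by rewrite (cover_partition pP).
have dB := implyP (dP (pblock P t)) (pblock_mem tc).
have [t' tt' eB] := domino_mem dB (etrans (mem_pblock P t) tc).
have t'A : t' \in A.
  apply: (subsetP (partitionS pP (pblock_mem tc))).
  by rewrite eB !inE eqxx orbT.
rewrite (bigD1 t') /=; last by rewrite t'A.
rewrite -{1}eB pblock_mem // big1 // => x /andP[/andP[xA tx] ne].
case: ifP => // xP.
(* A second block [[set t; x]] would equal [[set t; t']]; with [x != t'] this forces
   [x = t = t']. *)
have := def_pblock (partition_trivIset pP) xP (set21 t x).
rewrite eB => /setP e; move: (e t') (e x); rewrite !inE !eqxx !orbT (negbTE ne).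
by rewrite eq_sym (eq_sym t' x) (negbTE ne) !orbF => /esym/eqP tt /eqP xt;
  rewrite xt -tt eqxx in ne.
Qed.

End Domino.

(** * Unit triangles of the lattice *)

(* A cell (r, (a, b)) stands for the unit triangle with the vertical edge
   from (a, b) to (a, b + 1) and the third corner to the right of this edge
   if r, to the left otherwise. *)
Notation cell := (bool * (int * int))%type.

Definition corners (c : cell) : seq vertex :=
  let: (r, (a, b)) := c in
  [:: (a, b); (a, b + 1); if r then (a + 1, b) else (a - 1, b + 1)].

Definition tri (c : cell) : triangle := [fset p in corners c].

Definition nbrs (c : cell) : seq cell :=
  let: (r, (a, b)) := c in
  if r then [:: (false, (a, b)); (false, (a + 1, b)); (false, (a + 1, b - 1))]
  else [:: (true, (a, b)); (true, (a - 1, b)); (true, (a - 1, b + 1))].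

Lemma nbrs_uniq c : uniq (nbrs c).
Proof. by case: c => [[] [a b]] /=; rewrite !inE !xpair_eqE /=; lia. Qed.

Lemma corners_uniq c : uniq (corners c).
Proof. by case: c => [[] [a b]] /=; rewrite !inE !xpair_eqE /=; lia. Qed.

Lemma in_tri c p : (p \in tri c) = (p \in corners c).
Proof. by rewrite in_fset. Qed.

Lemma card_triI c c' :
  #|` tri c `&` tri c'| = (\sum_(p <- corners c) (p \in corners c'))%N.
Proof.
rewrite (_ : tri c `&` tri c' =
  [fset p in [seq p <- corners c | p \in corners c']]).
  rewrite card_fseq undup_id ?filter_uniq ?corners_uniq // size_filter.
  by rewrite -sum1_count big_mkcond; apply: eq_bigr => p _; case: ifP.
by apply/fsetP => p; rewrite !inE /= mem_filter andbC.
Qed.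

Definition vdiff (p q : vertex) : vertex := (p.1 - q.1, p.2 - q.2).

Definition shift (p q : vertex) : vertex := (p.1 + q.1, p.2 + q.2).

Lemma corners_shift d r q :
  corners (r, shift d q) = map (shift d) (corners (r, q)).
Proof.
by case: d q => [d1 d2] [a b]; case: r; rewrite /shift /= ?addrA.
Qed.

Lemma shift_inj d : injective (shift d).
Proof. by case: d => d1 d2 [a b] [a' b'] [/addrI -> /addrI ->]. Qed.

Lemma nbrs_shift d r q : nbrs (r, shift d q) =
  [seq (c.1, shift d c.2) | c <- nbrs (r, q)].
Proof.
by case: d q => [d1 d2] [a b]; case: r; rewrite /shift /= ?addrA.
Qed.

Lemma card_triI_shift d r q r' q' :
  #|` tri (r, shift d q) `&` tri (r', shift d q')| =
    #|` tri (r, q) `&` tri (r', q')|.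
Proof.
rewrite !card_triI !corners_shift big_map; apply: eq_bigr => p _.
by rewrite (mem_map (@shift_inj d)).
Qed.

Lemma shift0 q : shift q (0, 0) = q.
Proof. by case: q => a b; rewrite /shift /= !addr0. Qed.

Lemma shiftK q q' : shift q (vdiff q' q) = q'.
Proof. by case: q' => a b; rewrite /shift /= !subrKC. Qed.

(** Both sides are invariant under translation, so only the orientations and the offset [d] between
    the base points matter. *)
Lemma share_side_tri c c' : share_side (tri c) (tri c') = (c' \in nbrs c).
Proof.
case: c c' => [r q] [r' q'].
move: (shiftK q q'); move: (vdiff q' q) => d <-.
have -> : (r, q) = (r, shift q (0, 0)) by rewrite shift0.
rewrite /share_side card_triI_shift nbrs_shift.
rewrite -[(r', shift _ _)]/((fun c : cell => (c.1, shift q c.2)) (r', _)) mem_map;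
  last first.
  by move=> [r1 q1] [r2 q2] [-> e1 e2]; congr pair; apply: (@shift_inj q);
    rewrite /shift e1 e2.
rewrite card_triI /corners !big_cons big_nil.
(* Small offsets are listed one by one; for the others the cells are far apart and both sides
   compute to [false]. *)
case: d => x y; case: r; case: r'; case: x => [[|[|[|a]]]|[|[|a]]];
  case: y => [[|[|[|b]]]|[|[|b]]].
all: by [].
Qed.

Lemma tri_inj : injective tri.
Proof.
move=> [r [a b]] [r' [a' b']] e.
have : #|` tri (r, (a, b)) `&` tri (r', (a', b'))| = 3%N.
  by rewrite -e fsetIid card_fseq undup_id // corners_uniq.
rewrite card_triI /corners !big_cons big_nil.
case: r {e}; case: r'; rewrite !inE !xpair_eqE /= => h.
- by have -> : a = a' by [lia]; have -> : b = b' by lia.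
- lia.
- lia.
- by have -> : a = a' by [lia]; have -> : b = b' by lia.
Qed.

Definition unit_vectors : seq vertex :=
  [:: (1, 0); (-1, 0); (0, 1); (0, -1); (1, -1); (-1, 1)].

(** Completing the square in either variable confines both coordinates to [-1, 0, 1]. *)
Lemma sqdist1_cases (a b : int) : a ^+ 2 + a * b + b ^+ 2 == 1 ->
  (a, b) \in unit_vectors.
Proof.
move=> /eqP h.
have [/andP[a1 a2] /andP[b1 b2]] : -1 <= a <= 1 /\ -1 <= b <= 1.
  have h1 : (2 * a + b) ^+ 2 + 3 * b ^+ 2 = 4 by lia.
  have h2 : (2 * b + a) ^+ 2 + 3 * a ^+ 2 = 4 by lia.
  split; nia.
have [ea|[ea|ea]] : a = -1 \/ a = 0 \/ a = 1 by lia.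
all: have [eb|[eb|eb]] : b = -1 \/ b = 0 \/ b = 1 by lia.
all: by move: h; rewrite ea eb.
Qed.

(** After moving [p] to the origin, [q] and [r] are two of the six unit vectors, a finite check. The
    base point of the cell found is the lower end of the vertical side. *)
Lemma three_unit_vertices p q r :
  sqdist q p == 1 -> sqdist r p == 1 -> sqdist q r == 1 ->
  has (fun c => all [in [:: p; q; r]] (corners c))
      [seq (o, x) | o <- [:: true; false], x <- [:: p; q; r]].
Proof.
move=> qp rp qr.
have e1 := shiftK p q; have e2 := shiftK p r.
have {qp}: vdiff q p \in unit_vectors := sqdist1_cases qp.
have {rp}: vdiff r p \in unit_vectors := sqdist1_cases rp.
move: e1 e2.
move: (vdiff q p) (vdiff r p) => d1 d2 e1 e2 h2 h1.
have eqd : sqdist q r = sqdist d1 d2.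
  have cancel (a b c : int) : a + b - (a + c) = b - c by lia.
  by rewrite -e1 -e2 /sqdist /shift /= !cancel.
rewrite eqd in qr.
have -> : [:: p; q; r] = map (shift p) [:: (0, 0); d1; d2] by rewrite /= shift0
  e1 e2.
have all_shift c : all [in map (shift p) [:: (0, 0); d1; d2]]
  (corners (c.1, shift p c.2))
   = all [in [:: (0, 0); d1; d2]] (corners c).
  case: c => o x; rewrite corners_shift all_map; apply: eq_all => y /=.
  by rewrite -[RHS](mem_map (@shift_inj p)).
rewrite (_ : [seq (o, x) | o <- _, x <- _] = [seq (c.1, shift p c.2) |
   c <- [seq (o, x) | o <- [:: true; false], x <- [:: (0, 0); d1; d2]]]) //.
rewrite has_map (eq_has all_shift) {all_shift e1 e2 eqd}.
move: h1 h2 qr; rewrite !inE.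
by do 5?[case/orP]; move=> /eqP ->; do 5?[case/orP]; move=> /eqP ->.
Qed.

Lemma unit_triangle_tri t : unit_triangle t -> exists c, tri c == t.
Proof.
case/andP => /eqP ct /forallP dt.
have dist p q : p \in t -> q \in t -> p != q -> sqdist p q == 1.
  move=> pt qt ne; have /forallP/(_ [` qt]) := dt [` pt].
  by rewrite -val_eqE /= ne.
have : size (enum_fset t) = 3%N by [].
have := fset_uniq t.
case e: (enum_fset t) => [|p [|q [|r []]]] //= u _.
have mem x : (x \in t) = (x \in [:: p; q; r]) by rewrite -e.
move: u; rewrite !inE negb_or andbT => /andP[/andP[pq pr] qr].
have : sqdist q p == 1.
  by apply: dist; rewrite ?mem ?inE ?eqxx ?orbT // eq_sym.
have : sqdist r p == 1.
  by apply: dist; rewrite ?mem ?inE ?eqxx ?orbT // eq_sym.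
have : sqdist q r == 1 by apply: dist; rewrite ?mem ?inE ?eqxx ?orbT.
move=> d3 d2 d1; case/hasP: (three_unit_vertices d1 d2 d3) => c _ /allP h;
  exists c.
  rewrite eqEfcard; apply/andP; split; last first.
    by rewrite ct card_fseq undup_id ?corners_uniq //; case: (c) => [? []].
  by apply/fsubsetP => x; rewrite in_tri mem => /h.
Qed.

(* The vertical edge from (a, b) to (a, b + 1) lies in the hexagon. *)
Definition edge (n m : nat) (a b : int) : bool :=
  [&& 0 <= a <= (2 * n)%:Z, - (m + n)%:Z <= b < m%:Z
    & - m%:Z <= a + b < (m + n)%:Z].

(** The two excluded cells are the holes, which meet at [axis_vertex s]. Once the vertical edge lies
    in the hexagon, the third corner can leave it only across a vertical side of the hexagon. *)
Definition region (n m s : nat) (c : cell) : bool :=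
  let: (r, (a, b)) := c in
  edge n m a b &&
  if r then (a < (2 * n)%:Z) && ((a, b) != ((2 * s)%:Z - 1, - s%:Z))
  else (0 < a) && ((a, b) != ((2 * s)%:Z + 1, - s%:Z - 1)).

Lemma unit_triangle_tri_cell c : unit_triangle (tri c).
Proof.
apply/andP; split; first by rewrite card_fseq undup_id ?corners_uniq //;
  case: c => [? []].
apply/forallP => -[p /= pt]; apply/forallP => -[q /= qt].
apply/implyP; rewrite -val_eqE /=.
move: pt qt; rewrite !in_tri; case: c => [r [a b]]; rewrite !inE.
move=> hp hq; rewrite /sqdist.
by case: r hp hq; case/or3P => /eqP -> /or3P[] /eqP -> //=; rewrite ?eqxx // => _;
  lia.
Qed.

Lemma mem_hexagon_triangles n m c :
  (tri c \in hexagon_triangles n m) = all [in hexagon n m] (corners c).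
Proof.
rewrite /hexagon_triangles !inE /= unit_triangle_tri_cell andbT fpowersetE.
apply/fsubsetP/allP => h x; first by rewrite -in_tri; apply: h.
by rewrite in_tri; apply: h.
Qed.

(** The reflection turns vertical edges upside down, so the symmetric cells are those with
    [a + 2 b + 1 = 0]. *)
Lemma axis_reflection_tri r a b :
  [fset axis_reflection p | p in tri (r, (a, b))] = tri (r, (a, - a - b - 1)).
Proof.
apply/fsetP => p; rewrite in_tri; apply/imfsetP/idP => [[q /=]|].
  rewrite in_tri /axis_reflection; case: r; rewrite !inE => /or3P[] /eqP -> -> /=;
  rewrite !xpair_eqE; lia.
case: p => [x y] h; exists (axis_reflection (x, y)); last first.
  by rewrite /axis_reflection /=; congr pair; lia.
move: h; rewrite /= in_tri /axis_reflection; case: r; rewrite !inE !xpair_eqE /=;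
  lia.
Qed.

Lemma tri_holey_hexagon n m s c : (0 < s < n)%N ->
  (tri c \in holey_hexagon n m s) = region n m s c.
Proof.
move=> hs; have := mem_hexagon_triangles n m c.
rewrite /holey_hexagon /hexagon_triangles !inE /= => ->.
case: c => [r [a b]].
rewrite /axis_symmetric axis_reflection_tri (inj_eq tri_inj) /region /edge.
case: r; rewrite /= !in_hexagon !inE !xpair_eqE /=; lia.
Qed.

(** * Tilings of the holey hexagon, counted through cells *)

Section Count.

Variables n m s : nat.
Hypothesis hs : (0 < s < n)%N.

Let R := holey_hexagon n m s.

Lemma holey_hexagon_tri (t : R) : exists c, tri c == val t.
Proof.
by apply: unit_triangle_tri; case: t => t /=;
  rewrite /R /holey_hexagon !inE /= => /andP[/andP[_ ->]].
Qed.

Definition cell_of (t : R) : cell := xchoose (holey_hexagon_tri t).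

Lemma cell_ofK t : tri (cell_of t) = val t.
Proof. exact/eqP/(xchooseP (holey_hexagon_tri t)). Qed.

Lemma cell_of_inj : injective cell_of.
Proof. by move=> t t' e; apply: val_inj; rewrite -!cell_ofK e. Qed.

Lemma cell_of_region t : region n m s (cell_of t).
Proof. by rewrite -tri_holey_hexagon // cell_ofK; exact: valP. Qed.

Lemma cell_of_surj c : region n m s c -> exists t, cell_of t = c.
Proof.
rewrite -(tri_holey_hexagon _ _ hs) => h; exists [` h].
by apply: tri_inj; rewrite cell_ofK.
Qed.

Definition adj (t t' : R) : bool := share_side (val t) (val t').

(** [D] marks the cells still to be covered. It is a predicate on all cells, read only inside the
    region. *)
Definition count_tilings (D : cell -> bool) : nat :=
  #|domino_tilings adj [set t | D (cell_of t)]|.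

Lemma adjE t t' : adj t t' = (cell_of t' \in nbrs (cell_of t)).
Proof. by rewrite /adj -!cell_ofK share_side_tri. Qed.

Lemma adj_sym : symmetric adj.
Proof. by move=> t t'; rewrite /adj /share_side fsetIC. Qed.

Lemma rhombus_tilings_count (D : cell -> bool) :
  (forall c, region n m s c -> D c) -> #|rhombus_tilings R| = count_tilings D.
Proof.
move=> h; rewrite /count_tilings (_ : [set t | _] = [set: R]) //.
by apply/setP => t; rewrite !inE h // cell_of_region.
Qed.

Lemma count_tilings_ext (D D' : cell -> bool) :
  (forall c, region n m s c -> D c = D' c) -> count_tilings D = count_tilings D'.
Proof.
move=> h; rewrite /count_tilings; congr #|domino_tilings adj _|.
by apply/setP => t; rewrite !inE h // cell_of_region.
Qed.

Lemma count_tilings0 (D : cell -> bool) :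
  (forall c, region n m s c -> ~~ D c) -> count_tilings D = 1%N.
Proof.
move=> h; rewrite /count_tilings (_ : [set t | _] = set0) ?card_domino_tilings0
  //.
by apply/setP => t; rewrite !inE; apply/negbTE/h/cell_of_region.
Qed.

Lemma count_tilings_expand (D : cell -> bool) c : region n m s c -> D c ->
  count_tilings D =
  (\sum_(c' <- nbrs c | region n m s c' && D c')
     count_tilings (fun x => [&& D x, x != c & x != c']))%N.
Proof.
move=> /cell_of_surj[t <-] Dt.
rewrite /count_tilings (card_domino_tilings_expand adj_sym (t := t));
  last by rewrite inE.
rewrite -[RHS]big_filter.
rewrite (eq_bigr (fun t' => (fun c' => #|domino_tilings adj
   [set t0 | [&& D (cell_of t0), cell_of t0 != cell_of t & cell_of t0 != c']]|)
     (cell_of t'))); last first.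
  move=> t' _; congr #|domino_tilings adj _|; apply/setP => x.
  by rewrite !inE !(inj_eq cell_of_inj) negb_or andbC.
rewrite -big_filter -(big_map cell_of xpredT (fun c' => #|domino_tilings adj
   [set t0 | [&& D (cell_of t0), cell_of t0 != cell_of t & cell_of t0 != c']]|)).
apply: perm_big; apply: uniq_perm.
- by rewrite map_inj_uniq ?filter_uniq ?index_enum_uniq //; apply: cell_of_inj.
- by rewrite filter_uniq ?nbrs_uniq.
move=> c'; rewrite mem_filter; apply/mapP/idP.
  case=> t'; rewrite mem_filter inE adjE => /andP[/andP[Dt' tt'] _] ->.
  by rewrite cell_of_region Dt' tt'.
case/andP => /andP[/cell_of_surj[t' <-] Dt'] tt'.
by exists t' => //; rewrite mem_filter inE Dt' adjE tt' mem_index_enum.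
Qed.

End Count.

(** * Strips between consecutive vertical lines *)

(* The triangles on the left of the line {a = k}, where those with an edge on
   this line are kept only if the edge is in S. *)
Definition left_of (k : int) (S : pred int) (c : cell) : bool :=
  let: (r, (a, b)) := c in (a < k) || [&& ~~ r, a == k & S b].

(* The region left to tile while the strip between the lines {a = k} and
   {a = k + 1} is being processed: S is the set of the edges on {a = k} already
   reached by a path, S' that of the edges on {a = k + 1} not yet moved. *)
Definition straddle (k : int) (S S' : pred int) (c : cell) : bool :=
  let: (r, (a, b)) := c in
  if r then (a < k) || (a == k) && ~~ S b
  else (a <= k) || (a == k + 1) && S' b.

Arguments straddle : simpl never.
Arguments left_of : simpl never.
Arguments region : simpl never.

Section Sweep.

Variables n m s : nat.
Hypothesis hs : (0 < s < n)%N.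

Local Notation N := (@count_tilings n m s).
Local Notation reg := (region n m s).

Lemma straddle_start (k : int) (S : pred int) : N (left_of (k + 1) S) =
  N (straddle k pred0 S).
Proof.
apply: (count_tilings_ext hs) => -[[] [a b]] _; rewrite /left_of /straddle /=;
  first lia.
case: (S b); lia.
Qed.

Lemma straddle_ext (k : int) (S1 S1' S2 S2' : pred int) : S1 =1 S2 ->
  S1' =1 S2' ->
  N (straddle k S1 S1') = N (straddle k S2 S2').
Proof.
move=> h h'; apply: (count_tilings_ext hs) => -[[] [a b]] _; rewrite /straddle;
  by rewrite ?h ?h'.
Qed.

Lemma straddle_right (k : int) (S S' : pred int) b : straddle k S S'
  (true, (k, b)) = ~~ S b.
Proof. by rewrite /straddle ltxx eqxx. Qed.

Lemma straddle_right1 (k : int) (S S' : pred int) b : straddle k S S'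
  (true, (k + 1, b)) = false.
Proof. by rewrite /straddle; case: (S b); lia. Qed.

Lemma straddle_left (k : int) (S S' : pred int) b : straddle k S S'
  (false, (k, b)).
Proof. by rewrite /straddle lexx. Qed.

Lemma straddle_left1 (k : int) (S S' : pred int) b : straddle k S S'
  (false, (k + 1, b)) = S' b.
Proof. by rewrite /straddle eqxx /=; case: (S' b); lia. Qed.

Lemma straddle_step (k : int) (S S' : pred int) (b : int) : reg
  (false, (k + 1, b)) -> S' b ->
  N (straddle k S S') =
  (\sum_(f <- [:: b; (b + 1)%R] | reg (true, (k, f)) && ~~ S f)
    N (straddle k (fun x => S x || (x == f)) (fun x => S' x && (x != b))))%N.
Proof.
move=> hb Sb.
rewrite (@count_tilings_expand n m s hs _ (false, (k + 1, b))) ?straddle_left1 //.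
rewrite /nbrs addrK !big_cons !big_nil straddle_right1 andbF !straddle_right.
have F f : N (fun x : cell => [&& straddle k S S' x,
  x != (false, (k + 1, b)) & x != (true, (k, f))])
  = N (straddle k (fun x => S x || (x == f)) (fun x => S' x && (x != b))).
  apply: (count_tilings_ext hs) => -[[] [x y]] _; rewrite !xpair_eqE /straddle /=.
    case: (S y) => /=; lia.
  case: (S' y) => /=; lia.
by rewrite !F.
Qed.

(** With no left-pointing cell remaining on the line [k + 1], a free right-pointing cell can only be
    matched across its vertical edge. *)
Lemma straddle_dead (k : int) (S : pred int) (b : int) : reg (true, (k, b)) ->
  ~~ S b -> ~~ reg (false, (k, b)) ->
  N (straddle k S pred0) = 0%N.
Proof.
move=> hb Sb nb.
rewrite (@count_tilings_expand n m s hs _ (true, (k, b))) ?straddle_right //.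
by rewrite /nbrs !big_cons big_nil (negbTE nb) !straddle_left1 !andbF.
Qed.

Lemma straddle_forced_seq (k : int) (S : pred int) (l : seq int) : uniq l ->
  (forall b, b \in l -> [&& reg (true, (k, b)), ~~ S b & reg (false, (k, b))]) ->
  N (straddle k S pred0) =
  N (fun c => straddle k S pred0 c && ~~ ((c.2.1 == k) && (c.2.2 \in l))).
Proof.
elim: l => [_ _|b l IH /andP[bl ul] h].
  by apply: (count_tilings_ext hs) => c _; rewrite andbF andbT.
rewrite IH //; last by move=> x xl; apply: h; rewrite inE xl orbT.
have /and3P[h1 h2 h3] := h b (mem_head _ _).
rewrite (@count_tilings_expand n m s hs _ (true, (k, b))) ?straddle_right //;
  last first.
  by rewrite h2 /= (negbTE bl) andbF.
rewrite /nbrs !big_cons big_nil h3 !straddle_left1 straddle_left /= !andbF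
  (negbTE bl) andbF addn0.
apply: (count_tilings_ext hs) => -[[] [x y]] _;
  rewrite !xpair_eqE !inE /straddle /=.
  case: (S y) => /=; case: (y \in l) => /=; lia.
case: (y \in l) => /=; lia.
Qed.

(** The free right-pointing cells are forced to pair across their vertical edges. What stays on the
    line are the edges of paths and the edges whose right-pointing cell is missing; the latter is
    how the left hole absorbs a path. *)
Lemma straddle_end (k : int) (S : pred int) :
  (forall b, reg (true, (k, b)) -> ~~ S b -> reg (false, (k, b))) ->
  (forall b, S b -> reg (true, (k, b))) ->
  N (straddle k S pred0) = N (left_of k (fun b => S b || ~~ reg (true, (k, b)))).
Proof.
move=> h hS.
pose l := [seq b <- [seq (i%:Z - (m + n)%:Z)%R | i <- iota 0 (2 * m + n)] |
   reg (true, (k, b)) && ~~ S b].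
have ml b : (b \in l) = reg (true, (k, b)) && ~~ S b.
  rewrite mem_filter; apply: andb_idr => /andP[hb _].
  apply/mapP; move: hb; rewrite /region /edge => hb.
  exists (absz (b + (m + n)%:Z)); last lia.
  by rewrite mem_iota; lia.
have ul : uniq l by rewrite filter_uniq // map_inj_uniq ?iota_uniq // => x y; lia.
rewrite (straddle_forced_seq ul); last by move=> b; rewrite ml => /andP[h1 h2];
  rewrite h1 h2 h.
apply: (count_tilings_ext hs) => -[[] [a b]] rc; rewrite /straddle /left_of /= ml.
  case: (eqVneq a k) rc => [-> -> /=|/= _ _]; last by rewrite andbT orbF.
  by rewrite ltxx andbN.
case: (eqVneq a k) => [->|ne] /=; last by rewrite !orbF andbT lt_neqAle ne; lia.
by rewrite lexx ltxx /=; case: (S b); rewrite ?andbF ?andbT.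
Qed.

End Sweep.

(** * Path determinants *)

Definition binz (k : nat) (d : int) : int :=
  if d is Posz d' then 'C(k, d')%:Z else 0.

Lemma binz_neg k d : d < 0 -> binz k d = 0.
Proof. by case: d. Qed.

Lemma binz_gt k d : k%:Z < d -> binz k d = 0.
Proof. by case: d => //= d h; rewrite bin_small //; lia. Qed.

Lemma binzS k d : binz k.+1 d = binz k d + binz k (d - 1).
Proof.
case: d => [[|d]|d].
- by rewrite /= !bin0 addr0.
- rewrite (_ : d.+1%:Z - 1 = d%:Z) /=; last lia.
  by rewrite binS PoszD.
by rewrite !binz_neg ?addr0 //; lia.
Qed.

Section Sign.

Variable M : nat.

(** The sign of the permutation sorting the first [M] values of [h], or 0 if two of them coincide:
    the sign of a Vandermonde determinant. *)
Definition order_sign (h : nat -> int) : int :=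
  sgz (\prod_(i < M) \prod_(j < M | (i < j)%N) (h j - h i)).

Lemma sgz_prod (I : Type) (r : seq I) (P : pred I) (F : I -> int) :
  sgz (\prod_(i <- r | P i) F i) = \prod_(i <- r | P i) sgz (F i).
Proof. by apply: (big_morph _ (@sgzM _)); rewrite sgz1. Qed.

Lemma eq_sgz (x y : int) : (0 < x) = (0 < y) -> (x < 0) = (y < 0) ->
  sgz x = sgz y.
Proof. by case: (sgzP x); case: (sgzP y). Qed.

Lemma eq_order_sign h h' :
  (forall i j, (i < j < M)%N -> sgz (h j - h i) = sgz (h' j - h' i)) ->
  order_sign h = order_sign h'.
Proof.
move=> e; rewrite /order_sign !sgz_prod; apply: eq_bigr => i _.
by rewrite !sgz_prod; apply: eq_bigr => j ij; rewrite e // ij /=.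
Qed.

Lemma order_sign_incr h : (forall i j, (i < j < M)%N -> h i < h j) ->
  order_sign h = 1.
Proof.
move=> e; rewrite /order_sign !sgz_prod big1 // => i _.
rewrite sgz_prod big1 // => j ij; apply/gtr0_sgz.
by rewrite subr_gt0 e // ij /=.
Qed.

Lemma order_sign_det h :
  order_sign h = sgz (\det (\matrix_(i < M, j < M) h j ^+ i)).
Proof.
rewrite (_ : \matrix_(i, j) _ = Vandermonde M (\row_j h j)).
  rewrite det_Vandermonde; congr sgz; apply: eq_bigr => i _.
  by apply: eq_bigr => j _; rewrite !mxE.
by apply/matrixP => i j; rewrite !mxE.
Qed.

End Sign.

Section Columns.

Variables m s : nat.
Local Notation M := (2 * m)%N.

(* The number of lattice paths to the edge p from the i-th edge of the left
   side (i < M), or from the right hole (i = M). *)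
Definition paths (p : nat * int) (i : nat) : int :=
  if (i < M)%N then binz p.1 (i%:Z - m%:Z - p.2)
  else if (2 * s < p.1)%N then binz (p.1 - (2 * s).+1) (- s%:Z - 1 - p.2) else 0.

(** Rows are end points and columns starting points. The size exceeds the number of left edges by
    one because the right hole is also a starting point. *)
Definition path_det (w : nat -> nat * int) : int :=
  \det (\matrix_(j < M.+1, i < M.+1) paths (w j) i).

(* Up to an additive constant, twice the height of the midpoint of the edge;
   both holes are at -1. *)
Definition height (p : nat * int) : int := p.2 *+ 2 + p.1%:Z.

Lemma eq_path_det w w' : (forall j, (j <= M)%N -> w j = w' j) ->
  path_det w = path_det w'.
Proof.
move=> e; congr (\det _); apply/matrixP => j i; rewrite !mxE e //.
by rewrite -ltnS.
Qed.

Lemma path_det_alternate w j j' : (j < j' <= M)%N -> w j = w j' -> path_det w = 0.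
Proof.
case/andP => jj' j'M e.
have jM : (j < M.+1)%N by rewrite ltnS ltnW // (leq_trans jj').
apply: (@determinant_alternate _ _ _ (Ordinal jM)
  (Ordinal (j'M : (j' < M.+1)%N))).
  by rewrite -val_eqE /= neq_ltn jj'.
by move=> i; rewrite !mxE /= e.
Qed.

Lemma path_det_zero w j : (j <= M)%N ->
  (forall i, (i <= M)%N -> paths (w j) i = 0) ->
  path_det w = 0.
Proof.
move=> jM e; rewrite /path_det (expand_det_row _ (Ordinal (jM : (j < M.+1)%N))).
by rewrite big1 // => i _; rewrite mxE e ?mul0r // -ltnS.
Qed.

Lemma path_det_linear w w1 w2 t : (t <= M)%N ->
  (forall i, (i <= M)%N -> paths (w t) i = paths (w1 t) i + paths (w2 t) i) ->
  (forall j, j != t -> w1 j = w j) -> (forall j, j != t -> w2 j = w j) ->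
  path_det w = path_det w1 + path_det w2.
Proof.
move=> tM e e1 e2; pose t' := Ordinal (tM : (t < M.+1)%N).
rewrite -[path_det w1]mul1r -[path_det w2]mul1r.
apply: (@determinant_multilinear _ _ _ _ _ t').
- by apply/rowP => i; rewrite !mxE !mul1r e // -ltnS.
- apply/matrixP => j i; rewrite !mxE e1 //.
  by rewrite -[t]/(val t') val_eqE eq_sym neq_lift.
- apply/matrixP => j i; rewrite !mxE e2 //.
  by rewrite -[t]/(val t') val_eqE eq_sym neq_lift.
Qed.

End Columns.

(** * Sweeping one strip by multilinear expansion *)

Section Strip.

Variables n m s : nat.
Hypothesis hs : (0 < s < n)%N.
Local Notation M := (2 * m)%N.
Local Notation N := (@count_tilings n m s).
Local Notation reg := (region n m s).

Variables (k p : nat) (fz : nat -> nat * int) (eps : int).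

(* The paths j < p are alive: those with j < t are already on the line k, the
   others still on the line k + 1. The entries fz j for j >= p are frozen. *)
Definition strip_state (t : nat) (e : nat -> int) (j : nat) : nat * int :=
  if (j < t)%N then (k, e j) else if (j < p)%N then (k.+1, e j) else fz j.

Definition occupied (e : nat -> int) (i j : nat) : pred int :=
  fun b => has (fun x => e x == b) (index_iota i j).

Lemma occupiedP e i j b :
  reflect (exists2 x, (i <= x < j)%N & e x = b) (occupied e i j b).
Proof.
apply: (iffP hasP) => [[x xr /eqP ex]|[x xr ex]]; exists x => //.
- by rewrite mem_index_iota in xr.
- by rewrite mem_index_iota.
- exact/eqP.
Qed.

Hypothesis pM : (p <= M)%N.
Hypothesis fz_height : forall j, (p <= j < M)%N -> height (fz j) = -1.
Hypothesis forbidden : forall b f, reg (false, (k%:Z + 1, b)) ->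
  f \in [:: b; b + 1] ->
  ~~ reg (true, (k%:Z, f)) ->
  (forall i, (i <= M)%N -> paths m s (k, f) i = 0) \/
    (exists2 j, (p <= j <= M)%N & fz j = (k, f)).
Hypothesis pascal : forall b i, reg (false, (k%:Z + 1, b)) ->
  paths m s (k.+1, b) i = paths m s (k, b) i + paths m s (k, b + 1) i.
Hypothesis frozen_sign : forall b f, (p < M)%N -> reg (false, (k%:Z + 1, b)) ->
  f \in [:: b; b + 1] ->
  reg (true, (k%:Z, f)) -> sgz (-1 - height (k, f)) = sgz (-1 - height (k.+1, b)).

Definition strip_ok t (e : nat -> int) :=
  [/\ (forall j, (j < t)%N -> reg (true, (k%:Z, e j))),
  (forall j, (t <= j < p)%N -> reg (false, (k%:Z + 1, e j))),
  (forall i j, (i < j < t)%N -> e i != e j)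
    & (forall i j, (t <= i < j)%N -> (j < p)%N -> e i != e j)].

(** The factor [order_sign] makes the claim independent of the labelling of the paths, as the
    determinant alternates and the count does not change. *)
Definition strip_claim t (e : nat -> int) :=
  path_det m s (strip_state t e) = eps *
    order_sign M (height \o strip_state t e) *
     (N (straddle k%:Z (occupied e 0 t) (occupied e t p)))%:Z.

Hypothesis base : forall e, strip_ok p e -> strip_claim p e.

(** Pascal's rule splits row [t] of the determinant just as matching the cell of path [t] splits the
    count. A move that the matching forbids gives a zero row or two equal rows; an allowed move
    preserves the order sign. *)
Lemma strip_sweep t e : (t <= p)%N -> strip_ok t e -> strip_claim t e.
Proof.
move=> tp; rewrite -(subKn tp); move: (p - t)%N (leq_subr t p) => d dp {t tp}.
elim: d dp e => [|d IH] dp e.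
  by rewrite subn0; apply: base.
have {IH} := IH (ltnW dp).
have tS : (p - d = (p - d.+1).+1)%N by lia.
rewrite tS; set t := (p - d.+1)%N => IH [ok1 ok2 ok3 ok4].
have tp : (t < p)%N by rewrite /t; lia.
pose b := e t.
have rb : reg (false, (k%:Z + 1, b)) by apply: ok2; rewrite leqnn.
pose upd f j := if j == t then f else e j.
have lin : path_det m s (strip_state t e) =
  \sum_(f <- [:: b; b + 1]) path_det m s (strip_state t.+1 (upd f)).
  rewrite !big_cons big_nil addr0; apply: (@path_det_linear _ _ _ _ _ t).
  - by rewrite ltnW // (leq_trans tp).
  - by move=> i _; rewrite /strip_state ltnn tp ltnSn /upd eqxx pascal.
  - by move=> j jt; rewrite /strip_state /upd (negbTE jt) ltnS
    [(j <= t)%N]leq_eqVlt (negbTE jt).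
  - by move=> j jt; rewrite /strip_state /upd (negbTE jt) ltnS
    [(j <= t)%N]leq_eqVlt (negbTE jt).
have vanish f : f \in [:: b; b + 1] ->
  ~~ (reg (true, (k%:Z, f)) && ~~ occupied e 0 t f) ->
    path_det m s (strip_state t.+1 (upd f)) = 0.
  move=> fb; rewrite negb_and negbK => /orP[nr|].
    have [z|[j /andP[pj jM] ej]] := forbidden rb fb nr.
      apply: (@path_det_zero _ _ _ t); first by rewrite ltnW // (leq_trans tp).
      by move=> i iM; rewrite /strip_state ltnSn /upd eqxx z.
    apply: (@path_det_alternate _ _ _ t j); first by rewrite (leq_trans tp).
    rewrite /strip_state ltnSn /upd eqxx -ej.
    by rewrite ltnNge (leq_trans tp pj) ltnNge pj.
  case/occupiedP => x /= xt ex.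
  apply: (@path_det_alternate _ _ _ x t);
    first by rewrite xt ltnW // (leq_trans tp).
  by rewrite /strip_state /upd eqxx ltnS (ltnW xt) ltnSn ex (ltn_eqF xt).
have ob : occupied e t p b by apply/occupiedP; exists t; rewrite ?leqnn.
rewrite /strip_claim lin (@straddle_step n m s hs k%:Z (occupied e 0 t)
  (occupied e t p) b) //.
rewrite -big_filter (big_morph Posz PoszD (erefl 0%:Z)) big_filter mulr_sumr
  [RHS]big_mkcond.
apply: eq_big_seq => f fb; case: ifP => [/andP[rf nf]|/negbT/(vanish f fb)] //.
have neqf j : (j < t)%N -> e j != f.
  by move=> jt; apply/negP => /eqP ej; case/negP: nf; apply/occupiedP; exists j.
have okf : strip_ok t.+1 (upd f).
  split.
  - by move=> j; rewrite ltnS leq_eqVlt /upd; case: eqP => //= _; exact: ok1.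
  - by move=> j /andP[tj jp]; rewrite /upd gtn_eqF //; apply: ok2;
    rewrite jp andbT ltnW.
  - move=> i j /andP[ij]; rewrite ltnS leq_eqVlt /upd => /orP[/eqP ej|jt].
      by rewrite ej in ij *; rewrite (ltn_eqF ij) eqxx neqf.
    by rewrite (ltn_eqF jt) (ltn_eqF (ltn_trans ij jt)) ok3 // ij.
  - by move=> i j /andP[ti ij] jp;
    rewrite /upd (gtn_eqF ti) (gtn_eqF (ltn_trans ti ij)) ok4 // ij ltnW.
rewrite (IH _ okf); congr (_ * _ * Posz _).
  have fbE : (f == b) || (f == b + 1) by move: fb; rewrite !inE.
  (* A move changes the height by 1, whereas distinct edges of one line differ in height by at least
     2, so no path overtakes another; frozen entries are covered by [frozen_sign]. *)
  apply: eq_order_sign => i j /andP[ij jM] /=.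
  have same x : x != t -> strip_state t.+1 (upd f) x = strip_state t e x.
    by move=> xt; rewrite /strip_state /upd (negbTE xt) ltnS
      [(x <= t)%N]leq_eqVlt (negbTE xt).
  have newt : height (strip_state t.+1 (upd f) t) = f *+ 2 + k%:Z.
    by rewrite /strip_state ltnSn /upd eqxx.
  have oldt : height (strip_state t e t) = b *+ 2 + k.+1%:Z.
    by rewrite /strip_state ltnn tp.
  have [it|it] := eqVneq i t.
    rewrite it in ij *; rewrite newt oldt same ?gtn_eqF // {1 2}/strip_state.
    rewrite ltnNge (ltnW ij) /=; case: ifP => [jp|/negbT jp].
      have : b != e j by rewrite ok4 // leqnn.
      by rewrite /height /= => ne; apply: eq_sgz; lia.
    rewrite -leqNgt in jp; rewrite fz_height ?jp //.
    exact: (frozen_sign (leq_ltn_trans jp jM) rb fb rf).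
  have [jt|jt] := eqVneq j t; last by rewrite !same.
  rewrite jt in ij *; rewrite newt oldt same ?ltn_eqF // /strip_state ij /height
    /=.
  have : e i != f by rewrite neqf.
  by move=> ne; apply: eq_sgz; lia.
apply: straddle_ext => // x.
- apply/occupiedP/orP => /=.
    case=> y; rewrite ltnS leq_eqVlt /upd; case: eqP => [_ _ ->|_ /= yt ey];
      first by right.
    by left; apply/occupiedP; exists y.
  case=> [/occupiedP[y /= yt ey]|/eqP ->]; last by exists t; rewrite /upd ?eqxx.
  by exists y; rewrite /upd ?(ltn_eqF yt) // ltnS ltnW.
- apply/occupiedP/andP => /=.
    case=> y /andP[ty yp]; rewrite /upd (gtn_eqF ty) => ey; split.
      by apply/occupiedP; exists y => //; rewrite yp ltnW.
    by rewrite -ey eq_sym ok4 ?leqnn.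
  case=> /occupiedP[y /andP[ty yp] ey] xb; exists y.
    rewrite yp andbT ltn_neqAle ty andbT; apply: contraNneq xb => et.
    by rewrite -ey -et.
  rewrite /upd; case: eqP => // et; move: xb; by rewrite -ey et eqxx.
Qed.

End Strip.

(** * Passing from one vertical line to the next, and through the holes *)

Section Lines.

Variables n m s : nat.
Hypothesis hs : (0 < s < n)%N.
Hypothesis m_gt0 : (0 < m)%N.
Local Notation M := (2 * m)%N.
Local Notation N := (@count_tilings n m s).
Local Notation reg := (region n m s).

Definition line_state (k p : nat) (fz : nat -> nat * int) (e : nat -> int)
  (j : nat) : nat * int :=
  if (j < p)%N then (k, e j) else fz j.

Definition distinct_upto p (e : nat -> int) :=
  forall i j, (i < j < p)%N -> e i != e j.

(** The invariant strictly left of the line [k]. In [base_claim] the free right-pointing cells of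
    that line are still to be covered; the two differ by forced rhombi across the line and by the
    effect of a hole on it. *)
Definition line_claim k p fz eps := forall e,
  (forall j, (j < p)%N -> reg (false, (k%:Z, e j))) -> distinct_upto p e ->
  path_det m s (line_state k p fz e) =
  eps * order_sign M (height \o line_state k p fz e) *
    (N (left_of k (occupied e 0 p)))%:Z.

Definition base_claim k p fz eps := forall e,
  (forall j, (j < p)%N -> reg (true, (k%:Z, e j))) -> distinct_upto p e ->
  path_det m s (line_state k p fz e) =
  eps * order_sign M (height \o line_state k p fz e) *
    (N (straddle k (occupied e 0 p) pred0))%:Z.

(** A move out of the hexagon ends at [m], just above the top left edge, or at [-m - k - 1], just
    below the lowest edge reachable in [k] steps. *)
Lemma paths_outside k b f i : (k < 2 * n)%N -> edge n m (k%:Z + 1) b ->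
  f \in [:: b; b + 1] ->
  ~~ edge n m k f -> (i <= M)%N -> paths m s (k, f) i = 0.
Proof.
move=> kn eb; rewrite !inE => fb nef iM.
have [fE|fE] : f = m%:Z \/ f = - m%:Z - k%:Z - 1.
  by move: eb nef; rewrite /edge; case/orP: fb => /eqP ->; lia.
- rewrite /paths; case: ifP => [iM'|_]; first by rewrite binz_neg //=; lia.
  by case: ifP => // _; rewrite binz_neg //=; lia.
- rewrite /paths; case: ifP => [iM'|_]; first by rewrite binz_gt //=; lia.
  by case: ifP => // /= ks; rewrite binz_gt //=; lia.
Qed.

Lemma paths_pascal k b i : reg (false, (k%:Z + 1, b)) ->
  paths m s (k.+1, b) i = paths m s (k, b) i + paths m s (k, b + 1) i.
Proof.
move=> rb; rewrite /paths /=; case: ifP => _.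
  by rewrite binzS; congr (_ + binz _ _); lia.
case: (ltngtP (2 * s) k) => [ks|ks|ks].
- rewrite ltnS ltnW // (_ : k.+1 - (2 * s).+1 = (k - (2 * s).+1).+1)%N; last lia.
  by rewrite binzS; congr (_ + binz _ _); lia.
- by rewrite ltnS leqNgt ks addr0.
(* On the line [2 s + 1] the rule for the right hole fails only at its own edge, whose left-pointing
   cell is the removed one. *)
- rewrite -ks ltnSn subnn addr0; move: rb; rewrite /region xpair_eqE => rb.
  have [d0|d0] := ltP (- s%:Z - 1 - b) 0; first by rewrite binz_neg.
  by rewrite binz_gt //; lia.
Qed.

(** The vertical edges of the left hole and, as [source], of the right hole. *)
Definition sink : nat * int := ((2 * s).-1, - s%:Z).
Definition source : nat * int := ((2 * s).+1, - s%:Z - 1).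

Lemma line_step k p fz eps : (k < 2 * n)%N -> (p <= M)%N ->
  (forall j, (p <= j < M)%N -> height (fz j) = -1) ->
  (k == (2 * s).-1 -> exists2 j, (p <= j <= M)%N & fz j = sink) ->
  ((p < M)%N -> (k == (2 * s).-1) || (k == 2 * s)%N) ->
  base_claim k p fz eps -> line_claim k.+1 p fz eps.
Proof.
move=> kn pM hfz hsink hk base e re de.
have := @strip_sweep n m s hs k p fz eps pM hfz _ _ _ _ 0 e (leq0n _) _.
rewrite /strip_claim (_ : k.+1%:Z = k%:Z + 1); last lia.
rewrite (straddle_start m hs).
have -> : N (straddle k (occupied e 0 0) (occupied e 0 p)) =
  N (straddle k pred0 (occupied e 0 p)).
  by apply: straddle_ext.
apply.
(* A missing target inside the hexagon is the left hole, already present as a frozen row. *)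
- move=> b f rb fb nr; have [ef|nef] := boolP (edge n m k f).
    right; have /eqP kf : (k%:Z, f) == ((2 * s)%:Z - 1, - s%:Z).
      by move: nr; rewrite /region ef /= negb_and negbK; case/orP => //; lia.
    case: kf => k1 f1; have ks : k == (2 * s).-1 by lia.
    by have [j jp ej] := hsink ks; exists j => //; rewrite ej /sink f1 (eqP ks).
  by left=> i iM; apply: (paths_outside kn _ fb) => //; case/andP: rb.
- exact: paths_pascal.
- move=> b f /hk ks; rewrite /region !xpair_eqE !inE /height /= => rb fb rf.
  apply: eq_sgz; lia.
- move=> e' [ok1 _ ok3 _].
  have st j : strip_state k p fz p e' j = line_state k p fz e' j.
    by rewrite /strip_state /line_state; case: (j < p)%N.
  rewrite /strip_claim (@eq_path_det m s _ _ (fun j _ => st j)).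
  rewrite (@eq_order_sign M _ (height \o line_state k p fz e'));
    last by move=> i j _ /=; rewrite !st.
  rewrite base //; congr (_ * Posz _); apply: straddle_ext => // b.
  by rewrite /occupied /index_iota subnn.
- split=> //.
  by move=> j jp; rewrite (_ : k%:Z + 1 = k.+1%:Z) ?re //; lia.
  by move=> i j; rewrite ltn0 andbF.
  by move=> i j /= ij jp; apply: (de i j); rewrite ij jp.
Qed.

Lemma left_of_ext (k : int) (S S' : pred int) :
  (forall b, reg (false, (k, b)) -> S b = S' b) ->
    N (left_of k S) = N (left_of k S').
Proof.
move=> h; apply: (count_tilings_ext hs) => -[r [a b]] rc; rewrite /left_of.
by case: r rc => //=; case: (eqVneq a k) => //= -> /h ->.
Qed.

Lemma region_regular (k b : int) : 0 < k < (2 * n)%:Z -> k != (2 * s)%:Z - 1 ->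
  k != (2 * s)%:Z + 1 ->
  reg (true, (k, b)) = reg (false, (k, b)).
Proof. by move=> h1 h2 h3; rewrite /region !xpair_eqE; lia. Qed.

(** Off the lines of the holes the two cells at an edge are present or absent together, so the
    forced rhombi leave exactly the occupied edges. *)
Lemma base_regular k p fz eps : (0 < k < 2 * n)%N -> k != (2 * s).-1 ->
  k != (2 * s).+1 ->
  line_claim k p fz eps -> base_claim k p fz eps.
Proof.
move=> kn k1 k2 lc e re de.
have regE b : reg (true, (k%:Z, b)) =
  reg (false, (k%:Z, b)) by apply: region_regular; lia.
rewrite lc //; last by move=> j jp; rewrite -regE re.
congr (_ * Posz _); rewrite (straddle_end hs).
- by apply: left_of_ext => b rb; rewrite regE rb orbF.
- by move=> b; rewrite regE.
- by move=> b /occupiedP[x /= xp <-]; apply: re.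
Qed.

(* The path absorbed by the left hole becomes the frozen entry M - 1. *)
Lemma base_sink : line_claim (2 * s).-1 M (fun=> source) 1 ->
  base_claim (2 * s).-1 M.-1 (fun j => if j == M.-1 then sink else source) 1.
Proof.
move=> lc e re de.
pose e' j := if j == M.-1 then - s%:Z else e j.
have st j : (j <= M)%N -> line_state (2 * s).-1 M.-1
  (fun j => if j == M.-1 then sink else source) e j =
   line_state (2 * s).-1 M (fun=> source) e' j.
  rewrite /line_state /e' => jM; have [->|jM1] := eqVneq j M.-1.
    by rewrite ltnn (_ : (M.-1 < M)%N) //; lia.
  by rewrite (_ : (j < M.-1)%N = (j < M)%N) //; lia.
have kE : (2 * s).-1%:Z = (2 * s)%:Z - 1 by lia.
have nsink b : reg (true, ((2 * s).-1%:Z, b)) -> b != - s%:Z.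
  by rewrite /region xpair_eqE kE; lia.
rewrite (eq_path_det s st) (@eq_order_sign M _
  (height \o line_state (2 * s).-1 M (fun=> source) e')); last first.
  by move=> i j /andP[ij jM] /=; rewrite !st // ltnW // (ltn_trans ij).
rewrite lc.
- congr (_ * Posz _); rewrite (straddle_end hs).
  + apply: left_of_ext => b rb; apply/occupiedP/orP => /=.
      case=> x xM; rewrite /e'; case: eqP => [_ <-|/eqP xM1 ex].
        by right; rewrite /region xpair_eqE kE !eqxx !andbF.
      by left; apply/occupiedP; exists x => //=; lia.
    case=> [/occupiedP[x /= xM ex]|nr].
      by exists x; rewrite /e'; [lia | rewrite ltn_eqF].
    exists M.-1; first lia.
    rewrite /e' eqxx; move: nr rb; rewrite /region !xpair_eqE kE; lia.
  + by move=> b; rewrite /region !xpair_eqE kE; lia.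
  + by move=> b /occupiedP[x /= xM <-]; apply: re.
- move=> j jM; rewrite /e'; case: eqP => [_|/eqP jM1].
    by rewrite /region /edge xpair_eqE kE; lia.
  have := re j; rewrite (_ : (j < M.-1)%N); last lia.
  by move=> /(_ isT); rewrite /region !xpair_eqE kE; lia.
- move=> i j /andP[ij jM]; rewrite /e' (_ : (i == M.-1) = false); last lia.
  have [_|jM1] := eqVneq j M.-1; first by apply: nsink; apply: re; lia.
  by apply: de; lia.
Qed.

Lemma order_sign_swap h i j : (i < j < M)%N ->
  order_sign M (fun x => h (if x == i then j else if x == j then i else x)) =
    - order_sign M h.
Proof.
case/andP=> ij jM; have iM := ltn_trans ij jM.
rewrite !order_sign_det -sgzN; congr sgz.
pose i' := Ordinal iM; pose j' := Ordinal jM.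
have nij : i' != j' by rewrite -val_eqE /= ltn_eqF.
have -> : (\matrix_(x < M, y < M) h
  (if (y : nat) == i then j else if (y : nat) == j then i else y) ^+ x) =
   xcol i' j' (\matrix_(x < M, y < M) h y ^+ x) :> 'M[int]_M.
  apply/matrixP => x y; rewrite !mxE /=; congr (h _ ^+ _).
  by case: tpermP => [->|->|/eqP yi /eqP yj]; rewrite ?eqxx //;
     [rewrite gtn_eqF | rewrite -!val_eqE /= in yi yj *;
       rewrite (negbTE yi) (negbTE yj)].
by rewrite xcolE det_mulmx /tperm_mx det_perm odd_tperm nij expr1 mulrN1.
Qed.

Lemma path_det_swap w i j : (i < j <= M)%N ->
  path_det m s (fun x => w (if x == i then j else if x == j then i else x)) =
    - path_det m s w.
Proof.
case/andP=> ij jM; have iM : (i < M.+1)%N by rewrite ltnS ltnW // (leq_trans ij).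
rewrite /path_det.
pose i' := Ordinal iM; pose j' := Ordinal (jM : (j < M.+1)%N).
have nij : i' != j' by rewrite -val_eqE /= ltn_eqF.
have -> : (\matrix_(y < M.+1, x < M.+1) paths m s
  (w (if (y : nat) == i then j else if (y : nat) == j then i else y)) x) =
   xrow i' j' (\matrix_(y < M.+1, x < M.+1) paths m s (w y) x) :> 'M[int]_M.+1.
  apply/matrixP => x y; rewrite !mxE /=; congr (paths _ _ (w _) _).
  by case: tpermP => [->|->|/eqP yi /eqP yj]; rewrite ?eqxx //;
     [rewrite gtn_eqF | rewrite -!val_eqE /= in yi yj *;
       rewrite (negbTE yi) (negbTE yj)].
by rewrite xrowE det_mulmx /tperm_mx det_perm odd_tperm nij expr1 mulN1r.
Qed.

End Lines.

(* The matrix maps the Vandermonde matrix at 0, 1, ..., M - 1 to the one at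
   the e j. *)
Lemma det_injection_matrix M (e : nat -> nat) :
  (forall j, (j < M)%N -> (e j < M)%N) ->
    (forall i j, (i < j < M)%N -> e i != e j) ->
  \det (\matrix_(j < M, i < M) (e j == i)%:R : 'M[int]_M) =
    order_sign M (fun j => (e j)%:Z).
Proof.
move=> eM einj; set P := \matrix_(j, i) _.
have PPT : P *m P^T = 1%:M.
  apply/matrixP => i j; rewrite !mxE (bigD1 (Ordinal (eM i (ltn_ord i)))) //=
    big1.
    rewrite addr0 !mxE eqxx mul1r; congr ((nat_of_bool _)%:R);
      rewrite -val_eqE /=.
    by case: (ltngtP i j) => [ij|ij|->]; rewrite ?eqxx //; apply/negbTE;
      [rewrite eq_sym|]; apply: einj; rewrite ij ltn_ord.
  move=> x; rewrite -val_eqE /= => xi; rewrite !mxE.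
  by rewrite eq_sym (negbTE xi) mul0r.
have VP : \matrix_(i < M, j < M) (e j)%:Z ^+ i =
  (\matrix_(i < M, j < M) (j%:Z) ^+ i) *m P^T.
  apply/matrixP => i j; rewrite !mxE (bigD1 (Ordinal (eM j (ltn_ord j)))) //=
    big1.
    by rewrite !mxE eqxx mulr1 addr0.
  move=> x; rewrite -val_eqE /= => xi; rewrite !mxE.
  by rewrite eq_sym (negbTE xi) mulr0.
rewrite order_sign_det VP det_mulmx det_tr sgzM.
rewrite -(order_sign_det M (fun j => j%:Z)) order_sign_incr;
  last by move=> i j /andP[ij _].
have := congr1 (fun X => \det X) PPT; rewrite det_mulmx det_tr det1 mul1r -expr2.
by move/eqP; rewrite sqrf_eq1 => /orP[] /eqP ->.
Qed.

Section Final.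

Variables n m s : nat.
Hypothesis hs : (0 < s < n)%N.
Hypothesis m_gt0 : (0 < m)%N.
Local Notation M := (2 * m)%N.
Local Notation N := (@count_tilings n m s).
Local Notation reg := (region n m s).
Local Notation source := (source s).
Local Notation sink := (sink s).

Lemma base_start : base_claim n m s 0 M (fun=> source) 1.
Proof.
move=> e re de.
have eM j : (j < M)%N -> 0 <= e j + m%:Z < M%:Z.
  by move=> /re; rewrite /region /edge xpair_eqE; lia.
pose e' j := absz (e j + m%:Z).
have e'M j : (j < M)%N -> (e' j < M)%N by move=> /eM; rewrite /e'; lia.
have e'inj i j : (i < j < M)%N -> e' i != e' j.
  move=> ij; have := de _ _ ij; case/andP: ij => ij jM.
  by have := eM _ jM; have := eM _ (ltn_trans ij jM); rewrite /e'; lia.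
(* The [M] distinct edges fill the left side, so no cell remains. *)
have -> : N (straddle 0%N (occupied e 0 M) pred0) = 1%N.
  apply: (count_tilings0 hs) => -[[] [a b]] rc; rewrite /straddle; last first.
    by move: rc; rewrite /region xpair_eqE andbF orbF; lia.
  suff: a = 0 -> occupied e 0 M b.
    by move: rc; rewrite /region /edge xpair_eqE;
      case: (occupied _ _ _ _) => rc h; first lia; have : a <> 0 by [move/h]; lia.
  move=> a0; have bM : (absz (b + m%:Z) \in [seq e' j | j <- iota 0 M]).
    have u : uniq [seq e' j | j <- iota 0 M].
      rewrite map_inj_in_uniq ?iota_uniq // => i j;
        rewrite !mem_iota /= => iM jM eij.
      case: (ltngtP i j) => // ij.
        by have := e'inj i j; rewrite ij jM eij eqxx => /(_ isT).
      by have := e'inj j i; rewrite ij iM eij eqxx => /(_ isT).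
    have sub : {subset [seq e' j | j <- iota 0 M] <= iota 0 M}.
      by move=> x /mapP[j]; rewrite mem_iota => /andP[_ jM] ->;
        rewrite mem_iota /= e'M.
    have [|_ ->] := uniq_min_size u sub; first by rewrite size_map.
    by rewrite mem_iota; move: rc; rewrite /region /edge; lia.
  case/mapP: bM => j; rewrite mem_iota /= => jM ej; apply/occupiedP;
    exists j => //.
  by move: rc ej (eM _ jM); rewrite /e' /region /edge; lia.
rewrite mul1r mulr1.
have -> : order_sign M (height \o line_state 0 M (fun=> source) e) =
  order_sign M (fun j => (e' j)%:Z).
  apply: eq_order_sign => i j /andP[ij jM];
    rewrite /= /line_state jM (ltn_trans ij jM) /height /=.
  by have := eM _ jM; have := eM _ (ltn_trans ij jM) => h1 h2; apply: eq_sgz;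
    rewrite /e'; lia.
rewrite -det_injection_matrix //.
rewrite /path_det (expand_det_col _ ord_max) (bigD1 ord_max) //= big1 ?addr0;
  last first.
  move=> j jM; rewrite mxE /line_state.
  have -> : (j < M)%N by rewrite ltn_neqAle -ltnS ltn_ord andbT; move: jM;
    rewrite -val_eqE.
  by rewrite /paths /= ltnn mul0r.
rewrite mxE /line_state ltnn /paths ltnn /= ltnSn subnn.
rewrite subrr /= mul1r.
rewrite /cofactor /= addnn -signr_odd odd_double expr0 mul1r.
congr (\det _); apply/matrixP => j i; rewrite !mxE.
rewrite !lift_max ltn_ord /paths ltn_ord /=.
have := eM _ (ltn_ord j); rewrite /e' => hj.
have [E|ne] := eqVneq (absz (e j + m%:Z)) i.
  by rewrite (_ : i%:Z - m%:Z - e j = 0) //; lia.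
have [d0|d0] := ltP (i%:Z - m%:Z - e j) 0; first by rewrite binz_neg.
by rewrite binz_gt //; lia.
Qed.

(* The frozen entry M becomes a live path and swaps places with the sink,
   hence the sign. *)
Lemma base_source :
  line_claim n m s (2 * s).+1 M.-1 (fun j => if j == M.-1 then sink else source)
    1 ->
  base_claim n m s (2 * s).+1 M (fun=> sink) (-1).
Proof.
move=> lc.
have kE : (2 * s).+1%:Z = (2 * s)%:Z + 1 by lia.
(* The case where the path at the source edge carries the label [M.-1]. *)
have wlog_claim e : (forall j, (j < M)%N -> reg (true, ((2 * s).+1%:Z, e j))) ->
  distinct_upto M e ->
  e M.-1 = - s%:Z - 1 ->
  path_det m s (line_state (2 * s).+1 M (fun=> sink) e) =
  -1 * order_sign M (height \o line_state (2 * s).+1 M (fun=> sink) e) *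
    (N (straddle (2 * s).+1 (occupied e 0 M) pred0))%:Z.
  move=> re de eM.
  have M0 : (M.-1 < M)%N by lia.
  rewrite (straddle_end hs); last 2 first.
  - move=> b rb nb; have : b != - s%:Z - 1.
      by apply: contraNneq nb => ->; apply/occupiedP; exists M.-1.
    by move: rb; rewrite /region !xpair_eqE kE; lia.
  - by move=> b /occupiedP[x /= xM <-]; apply: re.
  rewrite (@left_of_ext n m s hs _ _ (occupied e 0 M.-1)); last first.
    move=> b rb; have -> : reg (true, ((2 * s).+1%:Z, b)).
      by move: rb; rewrite /region !xpair_eqE kE; lia.
    rewrite orbF; apply/occupiedP/occupiedP => /= -[x xM ex]; exists x => //;
      last lia.
    suff : x != M.-1 by lia.
    by apply: contraTneq rb => xE; rewrite -ex xE eM /region !xpair_eqE kE !eqxx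
      /= !andbF.
  have := lc e; set w2 := line_state _ _ _ e; set w3 := line_state _ _ _ e => h2.
  have e32 j : (j <= M)%N -> w3 (if j == M.-1 then M else if j == M then M.-1
    else j) = w2 j.
    rewrite /w3 /w2 /line_state => jM.
    have [->|j1] := eqVneq j M.-1; first by rewrite !ltnn.
    have [->|j2] := eqVneq j M; first by rewrite M0 eM (_ : (M < M.-1)%N = false)
      //; lia.
    have -> : (j < M)%N by lia.
    by have -> : (j < M.-1)%N by lia.
  have := @path_det_swap m s w3 M.-1 M; rewrite M0 leqnn => /(_ isT) /esym/eqP.
  rewrite eqr_oppLR => /eqP ->; rewrite (eq_path_det s e32) h2.
  - rewrite mul1r mulN1r mulNr; congr (- (_ * _)).
    apply: eq_order_sign => i j /andP[ij jM] /=.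
    (* The swapped entries, sink and source, have the same height, so only the determinant changes
       sign. *)
    have hgt x : (x < M)%N -> height (w2 x) = height (w3 x).
      move=> xM; rewrite /w2 /w3 /line_state xM.
      have [->|xM1] := eqVneq x M.-1; first by rewrite ltnn eM /height /=; lia.
      by rewrite (_ : (x < M.-1)%N) //; lia.
    by rewrite !hgt // (ltn_trans ij).
  - move=> j jM; have jM' : (j < M)%N by lia.
    have := re _ jM'; have := de j M.-1; rewrite jM M0 eM => /(_ isT).
    by rewrite /region !xpair_eqE kE; lia.
  - by move=> i j /andP[ij jM]; apply: de; lia.
move=> e re de.
have [/occupiedP[l /= lM el]|nocc] := boolP (occupied e 0 M (- s%:Z - 1));
  last first.
  (* If no path uses the source edge, its right-pointing cell cannot be covered, and the column of
     the right hole is zero. *)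
  rewrite (straddle_dead hs (b := - s%:Z - 1)) //; last 2 first.
  - by rewrite /region /edge !xpair_eqE kE; lia.
  - by rewrite /region !xpair_eqE kE !eqxx /= !andbF.
  rewrite mulr0 /path_det (expand_det_col _ ord_max) big1 // => j _.
  rewrite mxE /line_state; case: ifP => jM; last first.
    by rewrite /paths ltnn /= (_ : (2 * s < (2 * s).-1)%N = false) ?mul0r //; lia.
  rewrite /paths ltnn ltnSn subnn /=.
  have ne : e j != - s%:Z - 1.
    by apply: contraNneq nocc => ej; apply/occupiedP; exists j.
  have [d0|d0] := ltP (- s%:Z - 1 - e j) 0; first by rewrite binz_neg // mul0r.
  by rewrite binz_gt ?mul0r //; lia.
have [lE|lE] := eqVneq l M.-1; first by apply: wlog_claim; rewrite -?lE.
have lM1 : (l < M.-1 < M)%N by lia.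
(* Exchanging the labels [l] and [M.-1] changes the sign of both sides. *)
pose sw j := if j == l then M.-1 else if j == M.-1 then l else j.
have swM j : (j < M)%N -> (sw j < M)%N by rewrite /sw => jM; do 2?case: ifP => _;
  lia.
have swK : involutive sw.
  move=> j; rewrite /sw; have [->|jl] := eqVneq j l;
    first by rewrite eqxx eq_sym (negbTE lE).
  have [->|jM] := eqVneq j M.-1; first by rewrite eqxx.
  by rewrite (negbTE jl) (negbTE jM).
pose e' := e \o sw.
have st j : line_state (2 * s).+1 M (fun=> sink) e' j =
  line_state (2 * s).+1 M (fun=> sink) e (sw j).
  rewrite /line_state (_ : (sw j < M)%N = (j < M)%N) //; apply/idP/idP;
    last exact: swM.
  by move/swM; rewrite swK.
have := wlog_claim e'; rewrite (@eq_path_det m s _ _ (fun j _ => st j)).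
rewrite (@eq_order_sign M _ ((height \o line_state (2 * s).+1 M (fun=> sink) e)
  \o sw)); last first.
  by move=> i j _; rewrite /= !st.
rewrite path_det_swap; last by lia.
rewrite [order_sign _ _](@order_sign_swap m _ l M.-1) //.
rewrite (_ : N (straddle _ (occupied e' 0 M) _) =
  N (straddle (2 * s).+1 (occupied e 0 M) pred0)); last first.
  apply: straddle_ext => // b; apply/occupiedP/occupiedP => /= -[x xM ex].
    by exists (sw x); rewrite ?swM.
  by exists (sw x); rewrite ?swM // /e' /= swK.
rewrite mulrN mulNr => h; apply: oppr_inj; apply: h.
- by move=> j jM; apply/re/swM.
- move=> i j /andP[ij jM]; rewrite /e' /=.
  have : sw i != sw j by rewrite (inj_eq (can_inj swK)) ltn_eqF.
  rewrite neq_ltn => /orP[h|h]; last rewrite eq_sym; apply: de; rewrite h swM //.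
  exact: ltn_trans jM.
- by rewrite /e' /= /sw eqxx (_ : (M.-1 == l) = false) //; lia.
Qed.

End Final.

(** * Chaining the lines from the left side to the right side *)

Section Count.

Variables n m s : nat.
Hypothesis hs : (0 < s < n)%N.
Hypothesis m_gt0 : (0 < m)%N.
Local Notation M := (2 * m)%N.
Local Notation reg := (region n m s).
Local Notation source := (source s).
Local Notation sink := (sink s).

Lemma line_claim_before_sink k : (k.+1 < 2 * s)%N ->
  line_claim n m s k.+1 M (fun=> source) 1.
Proof.
elim: k => [|k IH] ks.
  apply: line_step => //; try lia; exact: base_start.
apply: line_step => //; try lia.
by apply: base_regular => //; try lia; apply: IH; lia.
Qed.

Lemma line_claim_at_source :
  line_claim n m s (2 * s).+1 M.-1 (fun j => if j == M.-1 then sink else source)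
    1.
Proof.
have frozen j : (M.-1 <= j < M)%N ->
  height (if j == M.-1 then sink else source) = -1.
  by move=> jM; rewrite (_ : j == M.-1) /height /=; lia.
have hsink : exists2 j, (M.-1 <= j <= M)%N & (if j == M.-1 then sink else source) =
  sink.
  by exists M.-1; rewrite ?eqxx //; lia.
have s2 : ((2 * s).-1.+1 = 2 * s)%N by lia.
apply: line_step => //; try lia.
apply: base_regular => //; try lia.
rewrite -s2; apply: line_step => //; try lia.
apply: base_sink => //.
have -> : (2 * s).-1 = (2 * s).-2.+1 by lia.
by apply: line_claim_before_sink; lia.
Qed.

Lemma line_claim_after_source k : (2 * s + k.+2 <= 2 * n)%N ->
  line_claim n m s (2 * s + k.+2) M (fun=> sink) (-1).
Proof.
elim: k => [|k IH] ks.
  rewrite addn2; apply: line_step => //; try lia.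
  by apply: base_source => //; exact: line_claim_at_source.
rewrite addnS; apply: line_step => //; try lia.
by apply: base_regular => //; try lia; apply: IH; lia.
Qed.

(** On the last line the paths end at all edges of the right side. Listed upwards they have order
    sign 1, and everything left of the line is the whole region. *)
Lemma rhombus_tilings_path_det :
  (#|rhombus_tilings (holey_hexagon n m s)|)%:Z =
  - \det (\matrix_(j < M.+1, i < M.+1)
      paths m s (if (j < M)%N then ((2 * n)%N, j%:Z - (m + n)%:Z) else sink) i).
Proof.
pose e (j : nat) := j%:Z - (m + n)%:Z.
have e_inj : distinct_upto M e by move=> i j ij; rewrite /e; lia.
have k2 : (2 * s + (2 * n - 2 * s).-2.+2 = 2 * n)%N by lia.
have e_reg j : (j < M)%N -> reg (false, ((2 * n)%:Z, e j)).
  by move=> jM; rewrite /e /region /edge xpair_eqE; lia.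
have := @line_claim_after_source (2 * n - 2 * s).-2;
  rewrite k2 => /(_ (leqnn _) e e_reg e_inj).
rewrite order_sign_incr ?mulr1; last first.
  by move=> i j /andP[ij jM]; rewrite /= /line_state jM (ltn_trans ij jM) /height
    /e /=; lia.
rewrite mulN1r /path_det => ->; rewrite opprK.
rewrite (rhombus_tilings_count hs (D := left_of (2 * n)%:Z (occupied e 0 M))) //.
move=> [r [a b]]; rewrite /region /left_of /edge => rc.
case: r rc => rc; first by rewrite /= orbF; lia.
have [aE|ne] := eqVneq a (2 * n)%:Z; last by lia.
rewrite aE in rc *; rewrite ltxx /=; apply/occupiedP;
  exists (absz (b + (m + n)%:Z)); rewrite /e; lia.
Qed.

End Count.

(** * Evaluation of the determinants *)

Lemma binz_nat k (d : nat) : binz k d%:Z = 'C(k, d)%:Z.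
Proof. by []. Qed.

Lemma binz_sub k d : binz k (k%:Z - d) = binz k d.
Proof.
have [d0|d0] := ltP d 0; first by rewrite (binz_neg _ d0) binz_gt //; lia.
have [dk|dk] := ltP k%:Z d; first by rewrite (binz_gt dk) binz_neg //; lia.
have -> : d = `|d|%N by lia.
have dk' : (`|d| <= k)%N by lia.
by rewrite subzn // !binz_nat bin_sub.
Qed.

(** Vandermonde's convolution: the bound [g + q < M] keeps the support of the second factor inside
    the range of summation. *)
Lemma binz_vandermonde (p q M g : nat) (a : int) : (g + q < M)%N ->
  \sum_(i < M) binz p (a - i%:Z) * binz q (i%:Z - g%:Z) = binz (p + q) (a - g%:Z).
Proof.
elim: q g => [|q IH] g gM.
  have gM' : (g < M)%N by lia.
  rewrite (bigD1 (Ordinal gM')) //= subrr mulr1 addn0 big1 ?addr0 // => i.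
  rewrite -val_eqE /= => ig; have [d0|d0] := ltP (i%:Z - g%:Z) 0.
    by rewrite (binz_neg _ d0) mulr0.
  by rewrite (@binz_gt 0) ?mulr0 //; lia.
rewrite addnS binzS -(IH g); last lia.
rewrite (_ : a - g%:Z - 1 = a - g.+1%:Z) -?(IH g.+1); try lia.
rewrite -big_split; apply: eq_bigr => i _ /=.
by rewrite binzS mulrDr (_ : i%:Z - g.+1%:Z = i%:Z - g%:Z - 1) //; lia.
Qed.

Lemma det_pascal M : \det (\matrix_(i < M, j < M) 'C(i, j)%:Z) = 1.
Proof.
rewrite det_trig ?big1 // => [i _|]; first by rewrite mxE binn.
by apply/is_trig_mxP => i j ij; rewrite mxE bin_small.
Qed.

(* Prolonging the paths at both ends into corners where they are forced. *)
Lemma toeplitz_pascal (n M : nat) :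
  (\matrix_(i < M, j < M) 'C(i, j)%:Z) *m
    (\matrix_(i < M, j < M) binz (2 * n) (n%:Z + i%:Z - j%:Z))
    *m (\matrix_(i < M, j < M) 'C(i, j)%:Z)^T =
      \matrix_(i < M, j < M) 'C(2 * n + i + j, n + i)%:Z.
Proof.
apply/matrixP => k l; rewrite !mxE.
transitivity (\sum_(j < M) binz (2 * n + k) (n%:Z + k%:Z - j%:Z) *
  binz l (j%:Z - 0%:Z)).
  apply: eq_bigr => j _; rewrite !mxE subr0 binz_nat; congr (_ * _).
  have := @binz_vandermonde (2 * n) k M 0 (n%:Z + j%:Z) (ltn_ord k).
  rewrite subr0 => e.
  rewrite -binz_sub (_ : (2 * n + k)%N%:Z - (n%:Z + k%:Z - j%:Z) = n%:Z + j%:Z);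
    last lia.
  rewrite -e; apply: eq_bigr => i _; rewrite !mxE subr0 binz_nat mulrC;
    congr (_ * _).
  by rewrite -binz_sub; congr binz; lia.
rewrite binz_vandermonde; last exact: ltn_ord.
by rewrite (_ : n%:Z + k%:Z - 0%:Z = (n + k)%N%:Z) //; lia.
Qed.

(** Vandermonde's convolution factors the matrix into a lower and an upper unitriangular one. *)
Lemma det_binomial (n M : nat) :
  \det (\matrix_(i < M, j < M) 'C(n + i + j, j)%:Z) = 1.
Proof.
have -> : \matrix_(i < M, j < M) 'C(n + i + j, j)%:Z =
   (\matrix_(i < M, j < M) 'C(i, j)%:Z) *m
     (\matrix_(i < M, j < M) binz (n + j) (j%:Z - i%:Z)).
  apply/matrixP => k l; rewrite !mxE.
  have := @binz_vandermonde (n + l) k M 0 l%:Z (ltn_ord k).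
  rewrite subr0 binz_nat (_ : n + k + l = n + l + k)%N => [<-|]; last lia.
  by apply: eq_bigr => i _; rewrite !mxE subr0 binz_nat mulrC.
rewrite det_mulmx det_pascal mul1r -det_tr det_trig ?big1 // => [i _|].
  by rewrite !mxE subrr /= bin0.
by apply/is_trig_mxP => i j ij; rewrite !mxE binz_neg //; lia.
Qed.

(** [toeplitz_pascal] preserves the determinant; pulling factorials out of rows and columns then
    leaves the matrix of [det_binomial]. *)
Lemma det_toeplitz (n M : nat) :
  (\det (\matrix_(i < M, j < M) binz (2 * n) (n%:Z + i%:Z - j%:Z)))%:~R =
  \prod_(i < M) (((2 * n + i)`! * i`!)%:R / ((n + i)`! ^ 2)%:R) :> rat.
Proof.
have <- : \det (\matrix_(i < M, j < M) 'C(2 * n + i + j, n + i)%:Z) =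
   \det (\matrix_(i < M, j < M) binz (2 * n) (n%:Z + i%:Z - j%:Z)).
  by rewrite -toeplitz_pascal !det_mulmx det_tr det_pascal mul1r mulr1.
pose A := diag_mx (\row_(i < M) ((2 * n + i)`!%:R / (n + i)`!%:R : rat)).
pose B := diag_mx (\row_(i < M) (i`!%:R / (n + i)`!%:R : rat)).
have E : map_mx intr (\matrix_(i < M, j < M) 'C(2 * n + i + j, n + i)%:Z) =
   A *m map_mx intr (\matrix_(i < M, j < M) 'C(2 * n + i + j, j)%:Z) *m B.
  apply/matrixP => i j; rewrite mul_mx_diag mul_diag_mx !mxE.
  have fne (k : nat) : k`!%:R != 0 :> rat by rewrite pnatr_eq0 -lt0n fact_gt0.
  have e1 : 'C(2 * n + i + j, n + i)%:R * ((n + i)`!%:R * (n + j)`!%:R) =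
    (2 * n + i + j)`!%:R :> rat.
    rewrite -!natrM; congr (_%:R); rewrite -(@bin_fact (2 * n + i + j) (n + i));
      last lia.
    by do 3?f_equal; lia.
  have e2 : 'C(2 * n + i + j, j)%:R * (j`!%:R * (2 * n + i)`!%:R) =
    (2 * n + i + j)`!%:R :> rat.
    rewrite -!natrM; congr (_%:R); rewrite -(@bin_fact (2 * n + i + j) j);
      last lia.
    by do 3?f_equal; lia.
  apply: (mulIf (mulf_neq0 (fne (n + i)) (fne (n + j)))).
  rewrite [LHS]e1 -e2; field; by rewrite !fne.
rewrite -det_map_mx E !det_mulmx det_map_mx det_binomial mulr1 !det_diag
  -big_split /=.
apply: eq_bigr => i _; rewrite !mxE natrM natrX expr2 mulf_div //.
Qed.

(** * Central binomial coefficients, MacMahon's product and a hypergeometric sum *)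

Lemma natr_neq0 (k : nat) : (0 < k)%N -> k%:R != 0 :> rat.
Proof. by move=> h; rewrite pnatr_eq0 -lt0n. Qed.

Lemma factr_neq0 (k : nat) : k`!%:R != 0 :> rat.
Proof. by apply/natr_neq0/fact_gt0. Qed.

Definition cbin (k : nat) : rat := 'C(2 * k, k)%:R.

Lemma cbin_neq0 k : cbin k != 0.
Proof. by apply: natr_neq0; rewrite bin_gt0; lia. Qed.

Lemma cbinE k : cbin k = (2 * k)`!%:R / (k`!%:R ^+ 2).
Proof.
rewrite -(@bin_fact (2 * k) k); last lia.
rewrite (_ : 2 * k - k = k)%N; last lia.
by rewrite !natrM; have := factr_neq0 k => h; rewrite /cbin; field.
Qed.

Lemma cbinS k : cbin k.+1 = cbin k * (2 * (2 * k + 1)%:R) / k.+1%:R.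
Proof.
rewrite !cbinE (_ : 2 * k.+1 = (2 * k).+2)%N; last lia.
rewrite !factS !natrM.
have h1 := factr_neq0 k.
have -> : (2 * k).+2%:R = 2 * k.+1%:R :> rat by rewrite -natrM; congr (_%:R); lia.
have -> : (2 * k + 1 = (2 * k).+1)%N by lia.
by field; rewrite h1 andbT; have := ler0n rat k; lra.
Qed.

(** The product over [j] telescopes, and the one over [i] then becomes a quotient of factorials. *)
Lemma prod_plane_partitions (n M : nat) :
  \prod_(1 <= i < n.+1) \prod_(1 <= j < n.+1) \prod_(1 <= k < M.+1)
      ((i + j + k - 1)%N%:R / (i + j + k - 2)%N%:R) =
  \prod_(i < M) (((2 * n + i)`! * i`!)%:R / ((n + i)`! ^ 2)%:R) :> rat.
Proof.
have h2 (i k : nat) : (0 < i)%N ->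
    \prod_(1 <= j < n.+1) ((i + j + k.+1 - 1)%N%:R / (i + j + k.+1 - 2)%N%:R) =
    (i + n + k)%N%:R / (i + k)%N%:R :> rat.
  move=> i0; elim: n => [|p IH].
    by rewrite big_geq // addn0 divff // natr_neq0 //; lia.
  rewrite big_nat_recr //= IH.
  have -> : (i + p.+1 + k.+1 - 1 = i + p.+1 + k)%N by lia.
  have -> : (i + p.+1 + k.+1 - 2 = i + p + k)%N by lia.
  have a1 : (i + k)%:R != 0 :> rat by apply: natr_neq0; lia.
  have a2 : (i + p + k)%:R != 0 :> rat by apply: natr_neq0; lia.
  move: ((i + k)%:R) ((i + p + k)%:R) ((i + p.+1 + k)%:R) a1 a2 => x y z x0 y0.
  by field; rewrite x0 y0.
(* The number [q] of factors is separated from [n] for the induction; it is used at [q = n]. *)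
have h3 (k : nat) : forall q, \prod_(1 <= i < q.+1)
  ((i + n + k)%N%:R / (i + k)%N%:R) =
    (((n + q + k)`! * k`!)%:R / ((n + k)`! * (q + k)`!)%:R) :> rat.
  elim=> [|q IH].
    rewrite big_geq // addn0 add0n divff // natrM mulf_neq0 ?factr_neq0 //.
  rewrite big_nat_recr //= IH.
  have -> : (n + q.+1 + k = (n + q + k).+1)%N by lia.
  have -> : (q.+1 + n + k = (n + q + k).+1)%N by lia.
  rewrite addSn !factS !natrM.
  have a1 := factr_neq0 (n + k); have a2 := factr_neq0 (q + k).
  have a3 : (q + k).+1%:R != 0 :> rat by apply: natr_neq0.
  move: ((q + k).+1%:R) ((n + q + k).+1%:R) ((q + k)`!%:R) ((n + k)`!%:R) a1 a2
    a3 => x y z t *.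
  by field; apply/and3P.
rewrite -(big_mkord xpredT (fun i =>
  ((2 * n + i)`! * i`!)%:R / ((n + i)`! ^ 2)%:R)).
under eq_bigr => i _ do rewrite exchange_big.
rewrite exchange_big /= big_add1 /=; apply: eq_bigr => k _.
rewrite mul2n -addnn.
have := h3 k n; rewrite expnS expn1 => <-.
by apply: eq_big_nat => i /andP[i0 _]; rewrite h2.
Qed.

(* The sum of wz_term over j is a terminating Pfaff-Saalschuetz sum;
   wz_cert is its WZ certificate. *)
Definition wz_term (n s u j : nat) : rat :=
  (-1) ^+ j * 'C(u, j)%:R / (s + 1 + j)%:R *
    ((n + u + 1 + j)`!%:R / (n + 1 + j)`!%:R)
  * (cbin (s + j) / cbin (n + 1 + j)).

Definition wz_cert (n s u k : nat) : rat :=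
  if k is j.+1 then
    (-1) ^+ j * 'C(u, j)%:R * ((n + u + 1 + j)`!%:R / (n + 1 + j)`!%:R)
    * (cbin (s + j) / cbin (n + 1 + j))
    * ((2 * u + n + 3)%:R * (n + u + j + 2)%:R * (2 * s + 2 * j + 1)%:R
       / ((s + u + 2)%:R * (s + j + 1)%:R * (2 * u + 2 * n + 3)%:R))
  else 0.

(** The quotient of the closed forms in [wz_sum] at [u.+1] and [u]. *)
Definition wz_ratio (n s u : nat) : rat :=
  ((2 * u + 3)%:R * (n%:R - s%:R + (u + 1)%:R) * (u + n + 2)%:R) /
    ((s + u + 2)%:R * (2 * u + 2 * n + 3)%:R).

Lemma bin_ratio (u j : nat) :
  'C(u, j.+1)%:R = (u%:R - j%:R) * 'C(u, j)%:R / (j%:R + 1) :> rat.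
Proof.
have j0 : j%:R + 1 != 0 :> rat by rewrite natr1 natr_neq0.
apply: (mulIf j0); rewrite divfK // natr1 -natrM mulnC mul_bin_left natrM.
have [ju|uj] := leqP j u; first by rewrite natrB.
by rewrite bin_small // !mulr0.
Qed.

Lemma wz_pair n s u j :
  wz_term n s u.+1 j - wz_ratio n s u * wz_term n s u j =
    wz_cert n s u j.+1 - wz_cert n s u j.
Proof.
have n0 := ler0n rat n; have s0 := ler0n rat s; have u0 := ler0n rat u.
case: j => [|j].
  rewrite /wz_term /wz_cert /wz_ratio !bin0 !addn0 expr0.
  have -> : (n + u.+1 + 1 = (n + u + 1).+1)%N by lia.
  rewrite factS natrM.
  have := factr_neq0 (n + 1); have := cbin_neq0 (n + 1).
  move: (cbin _) (cbin _) (_`!%:R) (_`!%:R) => a b c d b0 d0.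
  field.
  by rewrite b0 d0 !andbT; apply/and3P; split; apply: lt0r_neq0; lra.
have j0 := ler0n rat j.
rewrite /wz_term /wz_cert /wz_ratio.
have -> : (n + u.+1 + 1 + j.+1 = (n + u + 1 + j).+2)%N by lia.
have -> : (n + u + 1 + j.+1 = (n + u + 1 + j).+1)%N by lia.
have eB : 'C(u.+1, j.+1)%:R = (u%:R - j%:R) * 'C(u, j)%:R / (j%:R + 1) +
  'C(u, j)%:R :> rat.
  by rewrite binS natrD bin_ratio.
have eF k : k.+1`!%:R = k.+1%:R * k`!%:R :> rat by rewrite factS natrM.
rewrite !(addnS _ j) eB !eF bin_ratio !cbinS !exprS.
have := factr_neq0 (n + 1 + j); have := cbin_neq0 (n + 1 + j).
move: (cbin _) (cbin _) (_`!%:R) (_`!%:R) ('C(u, j)%:R) ((-1) ^+ j) =>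
  a b c d e g b0 d0.
field; rewrite b0 d0 /=.
by do !(apply/andP; split); apply: lt0r_neq0; lra.
Qed.

Lemma wz_sum n s u : (s <= n)%N ->
  \sum_(j < u.+1) wz_term n s u j =
  (2 * u + 1)%:R * cbin u * cbin s * (n - s + u)`!%:R * s`!%:R * u`!%:R
  / ((n - s)`!%:R * (s + u + 1)`!%:R * cbin (n + u + 1)).
Proof.
move=> sn; have n0 := ler0n rat n; have s0 := ler0n rat s.
elim: u => [|u IH].
  rewrite big_ord1 /wz_term /cbin !addn0 expr0 muln0 !bin0 fact0.
  have -> : (s + 1)`!%:R = (s%:R + 1) *
    s`!%:R :> rat by rewrite addn1 factS natrM natr1.
  have := cbin_neq0 (n + 1); have := factr_neq0 (n - s); have := factr_neq0 s;
    have := factr_neq0 (n + 1).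
  rewrite /cbin; move: ('C(2 * (n + 1), _)%:R) ('C(2 * s, _)%:R) ((n - s)`!%:R)
    (s`!%:R) ((n + 1)`!%:R) => a b c d e a0 b0 c0 d0.
  field; rewrite a0 b0 c0 d0 /=.
  by do !(apply/andP; split); rewrite ?a0 //; apply: lt0r_neq0; lra.
have u0 := ler0n rat u.
transitivity (wz_ratio n s u * \sum_(j < u.+1) wz_term n s u j).
  transitivity (\sum_(0 <= j < u.+2)
    (wz_ratio n s u * wz_term n s u j + (wz_cert n s u j.+1 - wz_cert n s u j))).
    by rewrite big_mkord; apply: eq_bigr => j _; rewrite -wz_pair subrKC.
  (* The certificate vanishes at 0 by definition and at [u.+2] because ['C(u, u.+1) = 0]; the same
     binomial kills the extra term of the shorter sum. *)
  rewrite big_split telescope_sumr //= subr0 bin_small // !(mulr0, mul0r) addr0.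
  rewrite big_nat_recr //= {2}/wz_term bin_small // !(mulr0, mul0r) addr0.
  by rewrite big_mkord mulr_sumr.
have q0 := ler0n rat (n - s).
have eN : n%:R = (n - s)%:R + s%:R :> rat by rewrite -natrD subnK.
have e1 : (n - s + u.+1)`!%:R = ((n - s)%:R + u%:R + 1) * (n - s + u)`!%:R :> rat.
  by rewrite addnS factS natrM -natr1 natrD.
have e2 : (s + u.+1 + 1)`!%:R = (s%:R + u%:R + 2) * (s + u + 1)`!%:R :> rat.
  have -> : (s + u.+1 + 1 = (s + u + 1).+1)%N by lia.
  by rewrite factS natrM; congr (_ * _); ring.
have e3 : cbin (n + u.+1 + 1) = cbin (n + u + 1) *
  (2 * (2 * (n + u + 1) + 1)%:R) / (n + u + 1).+1%:R.
  by rewrite -cbinS; congr cbin; lia.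
rewrite IH /wz_ratio e1 e2 e3 cbinS factS natrM eN.
have := cbin_neq0 (n + u + 1); have := factr_neq0 (n - s);
  have := factr_neq0 (s + u + 1).
move: (n - s)%N q0 eN {e1 e2 e3} => q q0 eN.
move: (cbin _) (cbin _) (cbin _) (q`!%:R) ((s + u + 1)`!%:R) => a b c d e.
move=> a0 b0 c0; field; rewrite a0 b0 c0 /=.
by do !(apply/andP; split); apply: lt0r_neq0; lra.
Qed.

(** * Lagrange interpolation and the Hankel system *)

Lemma lagrange_eval (m : nat) (x : nat -> rat) (q : {poly rat}) (y : rat) :
  (0 < m)%N -> injective x -> (size q <= m)%N ->
  q.[y] = \sum_(j < m) q.[x j] * \prod_(i < m | i != j) ((y - x i) / (x j - x i)).
Proof.
move=> m0 xi sq; rewrite {1}(lagrange_gen m0 xi sq) horner_sum;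
  apply: eq_bigr => j _.
rewrite hornerCM lagrangeE // hornerCM !horner_prod; congr (_ * _).
rewrite -prodfV -big_split; apply: eq_bigr => i _ /=.
by rewrite !hornerXsubC mulrC.
Qed.

Lemma prod_rising (s k : nat) : \prod_(i < k) (s + 1 + i)%:R =
  (s + k)`!%:R / s`!%:R :> rat.
Proof.
elim: k => [|k IH]; first by rewrite big_ord0 addn0 divff // factr_neq0.
rewrite big_ord_recr /= IH.
have -> : (s + 1 + k = (s + k).+1)%N by lia.
have -> : (s + k.+1 = (s + k).+1)%N by lia.
by rewrite factS natrM; ring.
Qed.

Lemma prod_falling (k : nat) : \prod_(i < k) (i%:R - k%:R) =
  (-1) ^+ k * k`!%:R :> rat.
Proof.
elim: k => [|k IH]; first by rewrite big_ord0 mulr1.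
rewrite big_ord_recl /= (eq_bigr (fun i : 'I_k => i%:R - k%:R)); last first.
  by move=> i _; rewrite /bump /= add1n -!natr1; ring.
by rewrite IH exprS factS natrM sub0r; ring.
Qed.

(** The Lagrange coefficients at [n - s] for the nodes [n + 1 + i], from which [n] cancels.
    Induction on [u] starts at [u = j], where the denominators give [(-1)^j j!]. *)
Lemma lagrange_weight (s u j : nat) : (j <= u)%N ->
  \prod_(i < u.+1 | (i : nat) != j) ((s + 1 + i)%:R / (i%:R - j%:R)) =
  (-1) ^+ j * 'C(u, j)%:R / (s + 1 + j)%:R *
    ((s + u + 1)`!%:R / (s`!%:R * u`!%:R)) :> rat.
Proof.
have s0 := ler0n rat s; have j0 := ler0n rat j.
have top : \prod_(i < j.+1 | (i : nat) != j) ((s + 1 + i)%:R / (i%:R - j%:R)) =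
  (-1) ^+ j * 'C(j, j)%:R / (s + 1 + j)%:R *
    ((s + j + 1)`!%:R / (s`!%:R * j`!%:R)) :> rat.
  have eS : (s + j + 1)`!%:R = (s%:R + j%:R + 1) * (s + j)`!%:R :> rat.
    by rewrite addn1 factS natrM -natr1 natrD.
  rewrite big_mkcond big_ord_recr /= eqxx mulr1
    (eq_bigr (fun i : 'I_j => (s + 1 + i)%:R / (i%:R - j%:R))); last first.
    by move=> i _; rewrite ltn_eqF.
  rewrite big_split /= prodfV prod_rising prod_falling binn eS invfM invr_sign.
  have := factr_neq0 s; have := factr_neq0 j.
  move: (j`!%:R) (s`!%:R) ((s + j)`!%:R) ((-1) ^+ j) => a b c d a0 b0; field.
  by rewrite a0 b0 /=; apply: lt0r_neq0; lra.
elim: u => [|u IH]; first by rewrite leqn0 => /eqP e; move: top; rewrite e.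
rewrite leq_eqVlt => /orP[/eqP e|ju]; first by move: top; rewrite e.
rewrite big_mkcond big_ord_recr -big_mkcond /= gtn_eqF // IH //.
have u0 : j%:R <= u%:R :> rat by rewrite ler_nat.
have -> : (s + u.+1 + 1 = (s + u + 1).+1)%N by lia.
have -> : 'C(u.+1, j)%:R = u.+1%:R * 'C(u, j)%:R / (u.+1%:R - j%:R) :> rat.
  have d0 : u.+1%:R - j%:R != 0 :> rat by rewrite -natr1; apply: lt0r_neq0; lra.
  apply: (mulIf d0); rewrite divfK // -natrB 1?ltnW // -!natrM; congr (_%:R).
  by rewrite mul_bin_down mulnC.
rewrite !factS !natrM.
have := factr_neq0 s; have := factr_neq0 u.
move: (u`!%:R) (s`!%:R) ((s + u + 1)`!%:R) ((-1) ^+ j) => a b c d a0 b0 => /=;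
  field.
by rewrite a0 b0 /=; do !(apply/andP; split); apply: lt0r_neq0; lra.
Qed.

Lemma size_prod_linear (I : Type) (r : seq I) (a b : I -> rat) :
  (size (\prod_(i <- r) ((a i)%:P * 'X + (b i)%:P))%R <= (size r).+1)%N.
Proof.
elim: r => [|i r IH]; first by rewrite big_nil size_poly1.
rewrite big_cons; apply: leq_trans (size_polyMleq _ _) _.
have h : (size ((a i)%:P * 'X + (b i)%:P)%R <= 2)%N.
  by rewrite size_MXaddC; case: ifP => // _; rewrite ltnS size_polyC_leq1.
by move: h IH; rewrite /=; lia.
Qed.

(** At [N] this is [cbin (N + t) / cbin N] times [(N + 1) ... (N + u)], a denominator common to all
    [t <= u]. *)
Definition ratio_poly (u t : nat) : {poly rat} :=
  (\prod_(i <- index_iota 0 t) (4%:P * 'X + (4 * i + 2)%:R%:P)) *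
  (\prod_(i <- index_iota t u) (1%:P * 'X + (i + 1)%:R%:P)).

Lemma size_ratio_poly u t : (t <= u)%N -> (size (ratio_poly u t) <= u.+1)%N.
Proof.
move=> tu; apply: leq_trans (size_polyMleq _ _) _.
have := size_prod_linear (index_iota 0 t) (fun=> 4) (fun i => (4 * i + 2)%:R).
have := size_prod_linear (index_iota t u) (fun=> 1) (fun i => (i + 1)%:R).
by rewrite /index_iota !size_iota /= subn0; move: (size _) (size _) => x y; lia.
Qed.

Lemma cbin_ratio_poly u t (N : nat) : (t <= u)%N ->
  cbin (N + t) * ((N + u)`!%:R / N`!%:R) = cbin N * (ratio_poly u t).[N%:R].
Proof.
move=> tu; rewrite -prod_rising -(big_mkord xpredT (fun i => (N + 1 + i)%:R)).
rewrite (big_cat_nat (n := t)) //= hornerM !horner_prod mulrA [RHS]mulrA;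
  congr (_ * _); last first.
  by apply: eq_bigr => i _; rewrite !hornerE -!natrD; congr (_%:R); lia.
elim: t {tu} => [|t IH]; first by rewrite !big_geq // addn0.
rewrite !big_nat_recr //= [RHS]mulrA -IH addnS cbinS.
have -> : (4%:P * 'X + (4 * t + 2)%:R%:P).[N%:R] =
  4 * N%:R + (4 * t + 2)%:R :> rat by rewrite !hornerE.
have N0 := ler0n rat N; have t0 := ler0n rat t.
move: (cbin _) (\prod_(_ <= _ < _) _) => a b; field.
by apply: lt0r_neq0; lra.
Qed.

(** A Lagrange coefficient at [n - s], times the factors, free of [t], that convert values of
    [ratio_poly u t] at the node and at [n - s] into values of [cbin]. *)
Definition weight (n s u j : nat) : rat :=
  (\prod_(i < u.+1 | (i : nat) != j) ((s + 1 + i)%:R / (i%:R - j%:R)))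
  * ((n + 1 + j + u)`!%:R / (n + 1 + j)`!%:R / cbin (n + 1 + j))
  * (cbin (n - s) * (n - s)`!%:R / (n - s + u)`!%:R).

(** Interpolation at [u + 1] nodes is exact for [ratio_poly u t], so the same weights serve every
    [t]. *)
Lemma weight_moments n s u t : (s <= n)%N -> (t <= u)%N ->
  \sum_(j < u.+1) weight n s u j * cbin (n + 1 + j + t) = cbin (n - s + t).
Proof.
move=> sn tu.
have inj : injective (fun j : nat => (n + 1 + j)%:R : rat) by move=> i j /eqP;
  rewrite eqr_nat eqn_add2l => /eqP.
have := lagrange_eval (n - s)%:R (ltn0Sn u) inj (size_ratio_poly tu).
have c0 := cbin_neq0 (n - s); have f0 := factr_neq0 (n - s);
  have g0 := factr_neq0 (n - s + u).
have -> : (ratio_poly u t).[(n - s)%:R] =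
  cbin (n - s + t) * ((n - s + u)`!%:R / (n - s)`!%:R) / cbin (n - s).
  by rewrite cbin_ratio_poly // mulrAC divff // mul1r.
move=> e.
have -> : cbin (n - s + t) = cbin (n - s + t) *
  ((n - s + u)`!%:R / (n - s)`!%:R) / cbin (n - s)
    * (cbin (n - s) * (n - s)`!%:R / (n - s + u)`!%:R).
  by field; rewrite c0 f0 g0.
rewrite e mulr_suml; apply: eq_bigr => j _; rewrite /weight mulrAC; congr (_ * _).
have d0 := cbin_neq0 (n + 1 + j).
have -> : (ratio_poly u t).[(n + 1 + j)%:R] =
  cbin (n + 1 + j + t) * ((n + 1 + j + u)`!%:R / (n + 1 + j)`!%:R) / cbin
    (n + 1 + j).
  by rewrite cbin_ratio_poly // mulrAC divff // mul1r.
rewrite (eq_bigr (fun i : 'I_u.+1 =>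
  ((n - s)%:R - (n + 1 + i)%:R) / ((n + 1 + j)%:R - (n + 1 + i)%:R))).
  by ring.
move=> i ij; rewrite natrB // -[RHS]mulrNN -invrN; congr (_ / _);
  by rewrite !natrD; ring.
Qed.

Lemma weight_sum n s u : (s <= n)%N ->
  \sum_(j < u.+1) weight n s u j * cbin (s + j) =
  (2 * u + 1)%:R * cbin u * cbin s * cbin (n - s) / cbin (n + u + 1).
Proof.
move=> sn.
transitivity ((s + u + 1)`!%:R / (s`!%:R * u`!%:R) *
  (cbin (n - s) * (n - s)`!%:R / (n - s + u)`!%:R)
   * \sum_(j < u.+1) wz_term n s u j).
  rewrite mulr_sumr; apply: eq_bigr => j _.
  rewrite /weight /wz_term lagrange_weight -1?ltnS //
    (_ : n + 1 + j + u = n + u + 1 + j)%N; last lia.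
  by ring.
rewrite wz_sum //.
have := factr_neq0 s; have := factr_neq0 u; have := factr_neq0 (n - s).
have := factr_neq0 (s + u + 1); have := factr_neq0 (n - s + u);
  have := cbin_neq0 (n + u + 1).
move: (cbin _) (_`!%:R) => a b *.
by field; do !(apply/andP; split).
Qed.

(** * The bordered determinant and its linear system *)

Lemma det_bordered (M : nat) (a : nat -> nat -> rat) (u w y : nat -> rat) :
  (forall j, (j < M)%N -> \sum_(i < M) a j i * y i = w j) ->
  \det (\matrix_(j < M.+1, i < M.+1)
     (if (j < M)%N then if (i < M)%N then a j i else w j
      else if (i < M)%N then u i else 0)) =
  - (\det (\matrix_(j < M, i < M) a j i) * \sum_(i < M) u i * y i).
Proof.
move=> h; set B := \matrix_(j, i) _.
(* This unitriangular column operation subtracts from the last column the combination [y] of the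
   others, clearing [w] and leaving minus the sum of the [u i * y i] in the corner. *)
pose E : 'M[rat]_M.+1 := \matrix_(i < M.+1, k < M.+1)
  (if (k < M)%N then (i == k)%:R else if (i < M)%N then - y i else 1).
have detE : \det E = 1.
  rewrite -det_tr det_trig ?big1 // => [i _|].
    by rewrite !mxE eqxx; case: ltnP.
  apply/is_trig_mxP => i j ij; rewrite !mxE.
  have -> : (i < M)%N by rewrite (leq_trans ij) // -ltnS.
  by rewrite -val_eqE /= gtn_eqF.
rewrite -[\det B]mulr1 -detE -det_mulmx.
have wid (i : 'I_M) : (widen_ord (leqnSn M) i < M)%N by case: i.
have last_col (j : 'I_M.+1) : (B *m E) j ord_max =
    if (j < M)%N then 0 else - \sum_(i < M) u i * y i.
  rewrite mxE big_ord_recr /= !mxE /= ltnn mulr1.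
  rewrite (eq_bigr (fun i : 'I_M => -
    ((if (j < M)%N then a j i else u i) * y i))).
    by rewrite sumrN; case: ifP => jM; rewrite ?addr0 // h // addNr.
  by move=> i _; rewrite !mxE /= ltnn ltn_ord mulrN; case: ifP.
rewrite (expand_det_col _ ord_max) (bigD1 ord_max) //= big1 ?addr0; last first.
  move=> j jM; rewrite last_col; have -> : (j < M)%N; last by rewrite mul0r.
  by rewrite ltn_neqAle -ltnS ltn_ord andbT; move: jM; rewrite -val_eqE.
rewrite last_col ltnn mulNr mulrC; congr (- (_ * _)).
rewrite /cofactor /= addnn -signr_odd odd_double expr0 mul1r.
congr (\det _); apply/matrixP => j i; rewrite !mxE.
rewrite (bigD1 (lift ord_max i)) //= !mxE !lift_max !ltn_ord eqxx mulr1 big1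
  ?addr0 //.
by move=> k ki; rewrite !mxE !lift_max !ltn_ord (negbTE ki) mulr0.
Qed.

(** Induction outwards from the middle: in the window from [m - 1 - t] to [m + t] the inner entries
    already vanish, and the two outer ones are equal with coefficient 1. *)
Lemma sym_window_kernel (m : nat) (r : nat -> rat) :
  (forall j, (j < 2 * m)%N -> r (2 * m - 1 - j)%N = r j) ->
  (forall t, (t < m)%N -> \sum_(j < 2 * m) r j *
    (binz (2 * t + 1) (j%:Z - (m - 1 - t)%N%:Z))%:~R = 0) ->
  forall j, (j < 2 * m)%N -> r j = 0.
Proof.
move=> sym h.
suff H t : (t < m)%N -> r (m + t)%N = 0.
  move=> j jm; have [mj|jm'] := leqP m j; first by rewrite -(subnKC mj) H //; lia.
  have e : (2 * m - 1 - j = m + (m - 1 - j))%N by lia.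
  by rewrite -sym // e H //; lia.
have [k] := ubnP t; elim: k t => // k IH t tk tm.
have zero j : (m - 1 - t < j < m + t)%N -> r j = 0.
  move=> jt; have [mj|jm'] := leqP m j; first by rewrite -(subnKC mj) IH //; lia.
  have e : (2 * m - 1 - j = m + (m - 1 - j))%N by lia.
  by rewrite -sym ?e ?IH //; lia.
have hi : (m + t < 2 * m)%N by lia.
have lo : (m - 1 - t < 2 * m)%N by lia.
have := h t tm; rewrite (bigD1 (Ordinal hi)) //= (bigD1 (Ordinal lo)) /=;
  last by rewrite -val_eqE /=; lia.
rewrite big1 ?addr0; last first.
  move=> j /andP[]; rewrite -!val_eqE /= => j1 j2.
  have [jl|jl] := ltnP j (m - 1 - t); first by rewrite binz_neg ?mulr0 //; lia.
  have [jh|jh] := ltnP (m + t) j; first by rewrite binz_gt ?mulr0 //; lia.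
  by rewrite zero ?mul0r //; lia.
rewrite subrr /= bin0 mulr1.
rewrite (_ : (m + t)%N%:Z - (m - 1 - t)%N%:Z = (2 * t + 1)%N%:Z) /=; last lia.
have e : (2 * m - 1 - (m + t) = m - 1 - t)%N by lia.
have := sym _ hi; rewrite e => ->; rewrite binn mulr1 => r2; lra.
Qed.

Lemma binz_vandermonde_rat (p q M g : nat) (a : int) : (g + q < M)%N ->
  \sum_(i < M) (binz p (a - i%:Z))%:~R * (binz q (i%:Z - g%:Z))%:~R =
    (binz (p + q) (a - g%:Z))%:~R :> rat.
Proof.
move=> gM; rewrite -(binz_vandermonde p a gM) rmorph_sum /=;
  apply: eq_bigr => i _.
by rewrite rmorphM.
Qed.

Section Solution.

Variables n m s : nat.
Hypothesis hs : (0 < s < n)%N.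
Hypothesis m_gt0 : (0 < m)%N.
Local Notation M := (2 * m)%N.

(** A combination of odd binomial rows centred in the window, chosen because convolving them with
    the matrix and with both borders gives binomials again. *)
Definition solution (i : nat) : rat :=
  \sum_(l < m) weight n s m.-1 l *
    (binz (2 * l + 1) (i%:Z - (m - 1 - l)%N%:Z))%:~R.

Lemma sum_solution (p : nat) (a : int) :
  \sum_(i < M) (binz p (a - i%:Z))%:~R * solution i =
  \sum_(l < m) weight n s m.-1 l *
    (binz (p + (2 * l + 1)) (a - (m - 1 - l)%N%:Z))%:~R.
Proof.
transitivity (\sum_(i < M) \sum_(l < m) weight n s m.-1 l *
    ((binz p (a - i%:Z))%:~R * (binz (2 * l + 1) (i%:Z - (m - 1 - l)%N%:Z))%:~R)).
  by apply: eq_bigr => i _; rewrite mulr_sumr; apply: eq_bigr => l _;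
    rewrite mulrCA.
rewrite exchange_big; apply: eq_bigr => l _ /=.
by rewrite -mulr_sumr binz_vandermonde_rat //; have := ltn_ord l; lia.
Qed.

(** The residual [r] is symmetric, and testing it against centred odd binomial rows yields central
    binomials, so that [weight_moments] and [sym_window_kernel] apply. *)
Lemma solution_spec j : (j < M)%N ->
  \sum_(i < M) (binz (2 * n) (n%:Z + i%:Z - j%:Z))%:~R * solution i =
  (binz (2 * n - (2 * s).+1) (- s%:Z - 1 - (j%:Z - (m + n)%N%:Z)))%:~R.
Proof.
pose r (j : nat) := \sum_(l < m) weight n s m.-1 l
    * (binz (2 * n + (2 * l + 1)) ((n + m + l)%N%:Z - j%:Z))%:~R
  - (binz (2 * n - (2 * s).+1) ((m + n - s)%N%:Z - 1 - j%:Z))%:~R.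
have r0 : forall j, (j < M)%N -> r j = 0.
  apply: sym_window_kernel => [i iM|t tm].
    rewrite /r; congr (_ - _).
      apply: eq_bigr => l _; congr (_ * _%:~R); rewrite -binz_sub; congr binz;
        lia.
    by congr (_%:~R); rewrite -binz_sub; congr binz; lia.
  rewrite /r; under eq_bigr => i _ do rewrite mulrBl mulr_suml.
  rewrite sumrB exchange_big /=.
  under eq_bigr => l _.
    under eq_bigr => i _ do rewrite -mulrA.
    rewrite -mulr_sumr binz_vandermonde_rat; last lia.
    over.
  rewrite binz_vandermonde_rat; last lia.
  have tm' : (t <= m.-1)%N by lia.
  have := @weight_moments n s m.-1 t (ltnW (proj2 (andP hs))) tm';
    rewrite prednK // => e.
  apply/eqP; rewrite subr_eq0; apply/eqP.
  transitivity (cbin (n - s + t)).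
    rewrite -e; apply: eq_bigr => l _; congr (_ * _); rewrite /cbin.
    rewrite (_ : _ - _ = (n + 1 + l + t)%N%:Z); last lia.
    by rewrite (_ : (2 * n + (2 * l + 1) + (2 * t + 1) = 2 * (n + 1 + l + t))%N);
      last lia.
  rewrite /cbin (_ : (m + n - s)%N%:Z - 1 - _ = (n - s + t)%N%:Z); last lia.
  by rewrite (_ : (2 * n - (2 * s).+1 + (2 * t + 1) = 2 * (n - s + t))%N);
    last lia.
move=> jM; have := r0 _ jM; rewrite /r => /eqP; rewrite subr_eq0 => /eqP e.
rewrite (_ : - s%:Z - 1 - (j%:Z - (m + n)%N%:Z) = (m + n - s)%N%:Z - 1 - j%:Z);
  last lia.
rewrite -e -[RHS](_ : \sum_(i < M) (binz (2 * n) ((n + j)%N%:Z - i%:Z))%:~R *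
  solution i = _).
  apply: eq_bigr => i _; congr (_%:~R * _); rewrite -binz_sub; congr binz; lia.
rewrite sum_solution; apply: eq_bigr => l _; congr (_ * _%:~R).
by rewrite -binz_sub; congr binz; have := ltn_ord l; lia.
Qed.

Lemma solution_source :
  \sum_(i < M) (binz (2 * s).-1 (i%:Z - m%:Z + s%:Z))%:~R * solution i =
  (2 * m - 1)%:R * cbin (m - 1) * cbin s * cbin (n - s) / cbin (m + n).
Proof.
transitivity (\sum_(i < M) (binz (2 * s).-1 ((s + m)%N%:Z - 1 - i%:Z))%:~R *
  solution i).
  by apply: eq_bigr => i _; congr (_%:~R * _); rewrite -binz_sub; congr binz; lia.
rewrite sum_solution.
have := @weight_sum n s m.-1 (ltnW (proj2 (andP hs))); rewrite prednK // => e.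
rewrite subn1 (_ : 2 * m - 1 = 2 * m.-1 + 1)%N; last lia.
rewrite (_ : m + n = n + m.-1 + 1)%N; last lia.
rewrite -e; apply: eq_bigr => l _; congr (_ * _); rewrite /cbin.
rewrite (_ : _ - _ = (s + l)%N%:Z); last (have := ltn_ord l; lia).
by rewrite (_ : ((2 * s).-1 + (2 * l + 1) = 2 * (s + l))%N); last lia.
Qed.

End Solution.

Theorem theorem1 (n m s : nat) (hn : (1 <= n)%N) (hm : (1 <= m)%N)
    (hs : (1 <= s <= n - 1)%N) :
  (#|rhombus_tilings (holey_hexagon n m s)|%:R : rat) =
  ((2 * m - 1) * 'C(2 * m - 2, m - 1) * 'C(2 * n - 2 * s, n - s)
     * 'C(2 * s, s))%N%:R / 'C(2 * m + 2 * n, m + n)%:R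
  * \prod_(1 <= i < n.+1) \prod_(1 <= j < n.+1) \prod_(1 <= k < (2 * m).+1)
      ((i + j + k - 1)%N%:R / (i + j + k - 2)%N%:R).
Proof.
have hs' : (0 < s < n)%N by lia.
have -> : #|rhombus_tilings (holey_hexagon n m s)|%:R =
    (#|rhombus_tilings (holey_hexagon n m s)|%:Z)%:~R :> rat by [].
rewrite rhombus_tilings_path_det // rmorphN /= -det_map_mx.
pose a (j i : nat) : rat := (binz (2 * n) (n%:Z + i%:Z - j%:Z))%:~R.
pose u (i : nat) : rat := (binz (2 * s).-1 (i%:Z - m%:Z + s%:Z))%:~R.
pose w (j : nat) : rat := (binz (2 * n - (2 * s).+1)
  (- s%:Z - 1 - (j%:Z - (m + n)%N%:Z)))%:~R.
(* The corner entry is 0 because the sink lies left of the right hole, where no path from that hole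
   arrives. *)
rewrite (_ : map_mx _ _ = \matrix_(j < (2 * m).+1, i < (2 * m).+1)
     (if (j < 2 * m)%N then if (i < 2 * m)%N then a j i else w j
      else if (i < 2 * m)%N then u i else 0)); last first.
  apply/matrixP => j i; rewrite !mxE /paths; case: (j < 2 * m)%N => /=.
    case: (i < 2 * m)%N; first by rewrite /a; congr (binz _ _)%:~R; lia.
    by rewrite (_ : (2 * s < 2 * n)%N) //; lia.
  case: (i < 2 * m)%N; first by rewrite /u; congr (binz _ _)%:~R; lia.
  by rewrite (_ : (2 * s < (2 * s).-1)%N = false) //; lia.
rewrite (@det_bordered _ a u w (solution n m s)); last first.
  by move=> j jM; rewrite /a /w solution_spec.
rewrite opprK /u solution_source // prod_plane_partitions -det_toeplitz mulrC;
  congr (_ * _).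
  have -> : (2 * m - 2 = 2 * (m - 1))%N by lia.
  have -> : (2 * n - 2 * s = 2 * (n - s))%N by lia.
  have -> : (2 * m + 2 * n = 2 * (m + n))%N by lia.
  by rewrite /cbin !natrM; ring.
(* Rows index end points here and starting points in [det_toeplitz], hence the transpose. *)
rewrite -det_map_mx -det_tr; congr (\det _); apply/matrixP => i j;
  rewrite !mxE //.
Qed.
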